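(* Let $p$ be a prime, $H\in[1,p)$ an integer, $\mathcal{K},\mathcal{M}\subseteq\mathbb{F}_p^*$ sets of cardinalities $K$ and $M$ respectively, $\chi$ a nonprincipal multiplicative character of $\mathbb{F}_p^*$, and let $(\alpha_h)_{h=1}^H$, $(\zeta_k)_{k\in\mathcal{K}}$, $(\eta_m)_{m\in\mathcal{M}}$ be complex weights all bounded by one in absolute value. Define $$ W_\chi=\sum_{h=1}^H\sum_{k\in\mathcal{K}}\sum_{m\in\mathcal{M}}\alpha_h\zeta_k\eta_m\,\chi(h+km). $$ Suppose that $M\le p^{1/3+o(1)}$. Then for any fixed integer $\ell\ge1$, $$ |W_\chi|\le HKM\left(p^{-1/2\ell}+H^{-1/2\ell}M^{-1/2\ell}+H^{-1/\ell}\right)\left(p^{1/4\ell}+K^{-1/2}p^{1/2\ell}\right)p^{o(1)}. $$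
   Context: $\mathbb{F}_p$ is the field with $p$ elements, identified with $\{0,\ldots,p-1\}$, $\mathbb{F}_p^*=\mathbb{F}_p\setminus\{0\}$; $\chi$ is extended by $\chi(0)=0$, and $h+km$ is computed in $\mathbb{F}_p$. A factor $p^{o(1)}$ denotes a quantity $f(p)$ with $\log|f(p)|/\log p\to0$ as $p\to\infty$ (possibly depending on the fixed $\ell$, but uniform in all other data). *)

(* Defs.v *)
From HB Require Import structures.
From mathcomp Require Export all_boot all_order all_algebra all_fingroup.
From mathcomp Require Export all_classical all_reals all_analysis.
From mathcomp Require Export complex.

Set Implicit Arguments.
Unset Strict Implicit.
Unset Printing Implicit Defensive.

Export Order.TTheory GRing.Theory Num.Theory.
Export numFieldNormedType.Exports.

Local Open Scope classical_set_scope.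
Local Open Scope ring_scope.

(* f stands for a factor p^{o(1)}; only its values at primes matter. Positivity
   is required because ln is total, with the junk value ln x = 0 for x <= 0. *)
Definition subpower (R : realType) (f : nat -> R) : Prop :=
  (forall p : nat, prime p -> 0 < f p) /\
  ln (f p) / ln p%:R @[p --> within [set q : nat | prime q] \oo] --> (0 : R).

(* Group homomorphisms from F^* to the multiplicative group of C. *)
Definition mul_char (F : finFieldType) (C : fieldType)
    (chi : {unit F} -> C) : Prop :=
  (forall u, chi u != 0) /\ (forall u v, chi (u * v)%g = chi u * chi v).

Definition nonprincipal (F : finFieldType) (C : fieldType)
    (chi : {unit F} -> C) : Prop :=
  exists u, chi u != 1.

(* Extension by zero; the units of a field are its nonzero elements. *)
Definition char_ext (F : finFieldType) (C : fieldType)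
    (chi : {unit F} -> C) (x : F) : C :=
  if insub x is Some u then chi u else 0.

Definition Wsum (R : realType) (p H : nat) (K M : {set 'F_p})
    (chi : {unit 'F_p} -> R[i]) (alpha : nat -> R[i]) (zeta eta : 'F_p -> R[i])
    : R[i] :=
  \sum_(1 <= h < H.+1) \sum_(k in K) \sum_(m in M)
    alpha h * zeta k * eta m * char_ext chi (h%:R + k * m).

(* Main.v *)
Require Import Defs.
From HB Require Import structures.
From mathcomp Require Import all_field.
From mathcomp Require Import ring lra zify.

Set Implicit Arguments.
Unset Strict Implicit.
Unset Printing Implicit Defensive.

(* Writing [h + k m = m (h / m + k)], one has [|W| <= \sum_v r(v) s(v)], where
   [r(v)] counts the pairs [(h, m)] with [h = v m] and
   [s(v) = |\sum_k zeta_k chi(v + k)|].  Hoelder's inequality bounds [|W|^(2l)] by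
   [(\sum_v r)^(2l - 2) (\sum_v r^2) (\sum_v s^(2l))].

   The moment of [s] expands into complete sums over the tuples [k : 'I_(2l) -> K].
   Tuples in which no value occurs exactly once number [O(K^l)]; for the others the
   simple node is sent to infinity and Weil's bound applies.  Weil's bound is obtained
   by counting points over the fields of order [Q^(2r)] with Stepanov's method (in
   Bombieri's form, where multiplicities come from a [Q^r]-th power instead of
   derivatives); this controls the inverse roots of the L-polynomial, whose power sums
   are the character sums over the extensions by Newton's identities.

   The energy [E(H) = \sum_v r^2] counts solutions of [h m' = h' m].  A shortest vector
   of the lattice [x m' = +- y m] gives [E(H) << M^2 (1 + H^2 / p) + (H / S)(E(S) + M^2)]
   for all [H] and [S], while Cauchy-Schwarz and the divisor bound give
   [E(S)^2 <= M E(S^2) p^o(1)].  Applied with [H = S^2] and [S = M <= p^(1/3 + o(1))],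
   these yield [E(M) <= M^2 p^o(1)], hence the bound for [E(H)]. *)

Local Open Scope ring_scope.

(** Weil's bound is proved for products of powers of [chi] whose total exponent [D] is prime to
    [Q - 1]. This condition acts twice: it separates the degrees in Stepanov's auxiliary polynomial,
    and through Bezout it gives a node at which the character is nontrivial, so that the L-series is
    a polynomial. A moment has total exponent divisible by [Q - 1], a conjugate being a power
    [Q - 2]; removing one simple node, of exponent [1] or [Q - 2], restores coprimality.

    Stepanov's method yields only upper bounds for the number of points with a given norm. They
    suffice because these numbers add up to a known total and [chi] sums to zero.

    The exponent 1/3 comes from the energy: the doubling inequality at [H = M^2] contributes
    [M^6 / p], and after Cauchy-Schwarz this must satisfy [M * (M^6 / p) << M^4], that is
    [M^3 << p]. *)

(** * Linear algebra for families of polynomials *)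

Lemma poly_lin_dep (F : fieldType) (T : finType) (n : nat) (w : T -> {poly F}) :
  (forall t, size (w t) <= n)%N -> (n < #|T|)%N ->
  exists u : T -> F, (exists t, u t != 0) /\ \sum_t u t *: w t = 0.
Proof.
move=> sw lt_n.
pose A : 'M[F]_(#|T|, n) := \matrix_(i, j) (w (enum_val i))`_j.
have : kermx A != 0.
  rewrite -mxrank_eq0 mxrank_ker -lt0n subn_gt0.
  exact: leq_ltn_trans (rank_leq_col A) lt_n.
case/rowV0Pn => v /sub_kermxP vA vN0.
exists (fun t => v 0 (enum_rank t)); split.
  case/matrix0Pn: vN0 => i [j]; rewrite ord1 => vj.
  by exists (enum_val j); rewrite enum_valK.
apply/polyP => k; rewrite coef_sum coef0.
case: (ltnP k n) => kn; last first.
  by rewrite big1 // => t _; rewrite coefZ nth_default ?mulr0 // (leq_trans (sw t)).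
have := congr1 (fun B : 'rV[F]_n => B 0 (Ordinal kn)) vA.
rewrite !mxE (reindex enum_rank) /=; last first.
  by apply: onW_bij; exists enum_val => x; rewrite ?enum_rankK ?enum_valK.
move=> vA0; rewrite -[RHS]vA0.
by apply: eq_bigr => t _; rewrite coefZ mxE enum_rankK.
Qed.

Lemma poly_lin_indep (F : fieldType) (T : finType) (w : T -> {poly F}) (u : T -> F) :
  (forall t, w t != 0) -> injective (fun t => size (w t)) ->
  (exists t, u t != 0) -> \sum_t u t *: w t != 0.
Proof.
move=> w0 sw_inj [t0 ut0].
case: (@arg_maxnP T t0 (fun t => u t != 0) (fun t => size (w t)) ut0) => t ut tmax.
apply/eqP => /(congr1 (fun g : {poly F} => g`_(size (w t)).-1)).
rewrite coef_sum coef0 (bigD1 t) //= big1 ?addr0 => [|t' nt'].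
  by move/eqP; rewrite coefZ mulf_eq0 (negbTE ut) -lead_coefE lead_coef_eq0 (negbTE (w0 t)).
rewrite coefZ; have [->|ut'] := eqVneq (u t') 0; first by rewrite mul0r.
rewrite nth_default ?mulr0 //.
have := tmax t' ut'; rewrite /geq /= leq_eqVlt => /orP[/eqP /sw_inj tt'|].
  by rewrite tt' eqxx in nt'.
by case: (size (w t)).
Qed.

(** * Frobenius powers in a field containing a finite field *)

Section FrobeniusPower.
Variables (F : finFieldType) (K : fieldType) (iota : {rmorphism F -> K}).
Implicit Types (x y : K) (c : F).

Local Notation Q := #|F|.

Lemma card_expn_pcharnat j : [char K].-nat (Q ^ j)%N.
Proof.
have [p p_pr pF] := finPcharP F.
have pQ : p.-nat Q.
  by rewrite -cardsT; exact: pprimeChar_pgroup pF.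
have pK : p \in [char K] by rewrite (fmorph_pchar iota).
rewrite pnatX; apply/orP; left.
by apply: sub_in_pnat pQ => q _ /eqP ->.
Qed.

Lemma frobD j x y : (x + y) ^+ (Q ^ j) = x ^+ (Q ^ j) + y ^+ (Q ^ j).
Proof. exact: exprDn_pchar (card_expn_pcharnat j). Qed.

Lemma frob_sum j (I : Type) (rs : seq I) (h : I -> K) :
  (\sum_(i <- rs) h i) ^+ (Q ^ j) = \sum_(i <- rs) h i ^+ (Q ^ j).
Proof.
apply: (big_morph (fun x => x ^+ (Q ^ j)) (frobD j)).
by rewrite expr0n expn_eq0 eqn0Ngt (ltnW (finRing_gt1 F)).
Qed.

Lemma frobN j x : (- x) ^+ (Q ^ j) = - x ^+ (Q ^ j).
Proof.
have := frobD j x (- x); rewrite subrr expr0n.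
rewrite expn_eq0 eqn0Ngt (ltnW (finRing_gt1 F)) /= => /esym/eqP.
by rewrite addrC addr_eq0 => /eqP.
Qed.

Lemma frob_inj j : injective (fun x => x ^+ (Q ^ j)).
Proof.
move=> x y /= xy; apply/eqP; rewrite -subr_eq0.
have := frobD j x (- y); rewrite frobN xy subrr => /eqP.
by rewrite expf_eq0 => /andP[].
Qed.

Lemma expf_cardX c j : c ^+ (Q ^ j) = c.
Proof. by elim: j => [|j IH]; rewrite ?expn0 ?expr1 // expnS exprM expf_card. Qed.

Lemma frob_iota c j : iota c ^+ (Q ^ j) = iota c.
Proof. by rewrite -rmorphXn /= expf_cardX. Qed.

Lemma frob_fixed_iota x : x ^+ Q = x -> exists c, x = iota c.
Proof.
move=> xQ; have := congr1 (fun g => (map_poly iota g).[x]) (finField_genPoly F).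
rewrite rmorphB /= map_polyXn map_polyX !hornerE xQ subrr.
rewrite rmorph_prod horner_prod => /esym/eqP.
rewrite prodf_seq_eq0 => /hasP[c _] /=.
rewrite map_polyXsubC hornerXsubC subr_eq0 => /eqP ->.
by exists c.
Qed.

End FrobeniusPower.

(** * Stepanov's method *)

Section Stepanov.
Variables (F : finFieldType) (K : fieldType) (iota : {rmorphism F -> K}).
Local Notation Q := #|F|.

(* Pole orders: the exponents [D i s + e + b q] are pairwise distinct because
   [q = 1] modulo [d] and [D] is prime to [d]. *)
Lemma stepanov_exponents_inj (d D s A i e b i' e' b' : nat) :
  coprime D d -> (A + D <= s)%N -> (i < d)%N -> (i' < d)%N ->
  (e <= A)%N -> (e' <= A)%N ->
  (D * (i * s) + e + b * (d * s).+1 = D * (i' * s) + e' + b' * (d * s).+1)%N ->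
  [/\ i = i', e = e' & b = b'].
Proof.
move=> cop AD id i'd eA e'A eqE.
set q := (d * s).+1 in eqE.
have d0 : (0 < d)%N by apply: leq_ltn_trans id.
have E1 : ((D * i + d * b) * q + (d * e + D * i') =
           (D * i' + d * b') * q + (d * e' + D * i))%N.
  have := congr1 (muln d) eqE; rewrite /q; nia.
have lt1 : (d * e + D * i' < q)%N by rewrite /q; nia.
have lt2 : (d * e' + D * i < q)%N by rewrite /q; nia.
have E2 : (D * i + d * b = D * i' + d * b')%N.
  have := congr1 (divn^~ q) E1.
  by rewrite !divnMDl // !divn_small // !addn0.
have no_gap j k m n : (j <= k)%N -> (k < d)%N ->
    (D * j + d * m = D * k + d * n)%N -> j = k.
  move=> jk kd E3; apply/eqP; rewrite eqn_leq jk -subn_eq0 -leqn0 leqNgt.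
  apply/negP => gap; have : (d %| D * (k - j))%N.
    by apply/dvdnP; exists (m - n)%N; nia.
  rewrite Gauss_dvdr 1?coprime_sym // => /(dvdn_leq gap); rewrite leqNgt; move/negP; apply.
  exact: leq_ltn_trans (leq_subr _ _) kd.
have ii' : i = i'.
  have [ii|/ltnW ii] := leqP i i'; first exact: no_gap E2.
  by apply/esym; apply: no_gap (esym E2).
subst i'; move: E2 => /eqP; rewrite eqn_add2l eqn_pmul2l // => /eqP bb'.
by subst b'; split=> //; move/eqP: eqE; rewrite eqn_add2r eqn_add2l => /eqP.
Qed.

(* [F1 = \sum u_(i,e,b) f^(i s) X^(e + b q)] is nonzero, its monomials having
   distinct degrees, while linear algebra makes
   [G = \sum u_(i,e,b) a^i f^((d - 1 - i) s) X^(e q + b)] vanish; at the points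
   counted, [F1(x)^q f(x)^((d - 1) s) = G(x) = 0]. *)
Lemma stepanov_bound (f : {poly F}) (a : F) (r s D : nat) (xs : seq K) :
  (2 < Q)%N -> size f = D.+1 -> coprime D Q.-1 ->
  (Q ^ r = (Q.-1 * s).+1)%N -> (2 * D <= s)%N -> a != 0 -> uniq xs ->
  (forall x, x \in xs -> x ^+ (Q ^ r * Q ^ r) = x /\
     (map_poly iota f).[x] ^+ (s * (Q ^ r).+1) = iota a) ->
  (size xs <= Q ^ r * (s + 3 * D + 1))%N.
Proof.
move=> Q2 sf cop qE Ds a0 uxs xsP.
set q := (Q ^ r)%N in qE xsP *.
set d := Q.-1 in qE cop.
have d2 : (1 < d)%N by rewrite /d -ltnS prednK // (ltn_trans _ Q2).
have D0 : (0 < D)%N.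
  by case: D cop {sf Ds} => //; rewrite /coprime gcd0n => /eqP dE; rewrite dE in d2.
(* [A] is the largest value that [stepanov_exponents_inj] allows. With [B + 1 = s + 2 * D] the
   [d * (A + 1) * (B + 1)] unknowns outnumber the coefficients of [G], while the degree of [F1],
   mainly [B * q], stays within the claimed bound. *)
pose A := (s - D)%N; pose B := (s + 2 * D).-1.
have AD : (A + D <= s)%N by rewrite subnK //; lia.
pose T := ('I_d * 'I_A.+1 * 'I_B.+1)%type.
pose wG (t : T) : {poly F} :=
  a ^+ t.1.1 *: (f ^+ ((d.-1 - t.1.1) * s) * 'X^(t.1.2 * q + t.2)).
pose wF (t : T) : {poly F} := f ^+ (t.1.1 * s) * 'X^(t.1.2 + t.2 * q).
have f0 : f != 0 by rewrite -size_poly_gt0 sf.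
have sfX k : size (f ^+ k) = (D * k).+1.
  by rewrite -[LHS]prednK ?size_poly_gt0 ?expf_neq0 // size_exp sf.
have sfXX k e : size (f ^+ k * 'X^e) = (D * k + e).+1.
  by rewrite size_mulXn ?expf_neq0 // sfX addnS addnC.
have wF0 t : wF t != 0 by rewrite -size_poly_gt0 sfXX.
have szG t : (size (wG t) <= D * (d.-1 * s) + A * q + B.+1)%N.
  rewrite (leq_trans (size_scale_leq _ _)) // sfXX addnS ltnS -addnA.
  apply: leq_add; first by rewrite leq_mul2l leq_mul2r leq_subr !orbT.
  by apply: leq_add; [rewrite leq_mul2r -ltnS ltn_ord orbT | rewrite -ltnS].
have cardT : (D * (d.-1 * s) + A * q + B.+1 < #|{: T}|)%N.
  rewrite !card_prod !card_ord /A /B qE.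
  have -> : (s + 2 * D).-1.+1 = (s + 2 * D)%N by lia.
  have [s' ->] : exists s', s = (2 * D + s')%N by exists (s - 2 * D)%N; lia.
  have -> : (2 * D + s' - D = D + s')%N by lia.
  have [d' ->] : exists d', d = d'.+2 by exists d.-2; lia.
  have [D' ->] : exists D', D = D'.+1 by exists D.-1; lia.
  rewrite /=. nia.
have [u [un0 Gu]] := poly_lin_dep szG cardT.
pose F1 := \sum_t u t *: wF t.
have F1n0 : F1 != 0.
  apply: poly_lin_indep => // -[[i e] b] [[i' e'] b'] /=; rewrite !sfXX => -[].
  rewrite !addnA qE => eqE.
  have [] := stepanov_exponents_inj cop AD (ltn_ord i) (ltn_ord i') _ _ eqE.
  - by rewrite -ltnS.
  - by rewrite -ltnS.
  by move=> /val_inj -> /val_inj -> /val_inj ->.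
have sF1 : (size F1 <= (D * (d.-1 * s) + A + B * q).+1)%N.
  apply: (leq_trans (size_sum _ _ _)); apply/bigmax_leqP => t _.
  rewrite (leq_trans (size_scale_leq _ _)) // sfXX ltnS -addnA.
  apply: leq_add; last first.
    by apply: leq_add; rewrite ?leq_mul2r -ltnS ltn_ord ?orbT.
  rewrite leq_mul2l; apply/orP; right.
  by rewrite leq_mul2r -ltnS prednK ?ltn_ord ?orbT // ltnW.
have rootF1 : all (root (map_poly iota F1)) xs.
  apply/allP => x /xsP [xq fx].
  have fx0 : (map_poly iota f).[x] != 0.
    apply/eqP => fx0; move/eqP: fx; rewrite fx0 expr0n muln_eq0 /=.
    have -> : (s == 0)%N = false by apply/eqP; lia.
    by rewrite eq_sym fmorph_eq0 (negbTE a0).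
  (* Since [a = f(x)^(s (q + 1))], the power [f(x)^(i s q)] equals [a^i f(x)^(- i s)]; the factor
     [f(x)^((d - 1) s)] clears these denominators. *)
  have : (map_poly iota F1).[x] ^+ q * (map_poly iota f).[x] ^+ (d.-1 * s) = 0.
    have := congr1 (fun g => (map_poly iota g).[x]) Gu.
    rewrite /= rmorph0 horner0 => <-.
    rewrite /F1 !rmorph_sum /= !horner_sum (frob_sum iota) mulr_suml.
    apply: eq_bigr => t _.
    rewrite /wF /wG !linearZ /= !rmorphM /= !rmorphXn /= map_polyX !hornerE.
    have ti : (t.1.1 <= d.-1)%N by rewrite -ltnS prednK ?ltn_ord // ltnW.
    have xE : x ^+ ((t.1.2 + t.2 * q) * q) = x ^+ (t.1.2 * q + t.2).
      by rewrite mulnDl -mulnA exprD (mulnC t.2) [x ^+ (q * q * _)]exprM xq -exprD.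
    rewrite /= !exprMn (frob_iota iota) -!exprM -/q xE -fx -exprM.
    rewrite -!mulrA; congr (_ * _); rewrite mulrCA mulrC !mulrA -!exprD.
    congr (_ ^+ _ * _); move: (d.-1) (t.1.1 : nat) ti; clear => m i im.
    by rewrite -{1}(subnK im); nia.
  by move/eqP; rewrite mulf_eq0 !expf_eq0 (negbTE fx0) andbF orbF => /andP[].
have := max_poly_roots _ rootF1 uxs; rewrite map_poly_eq0 size_map_poly F1n0.
move=> /(_ isT) lt1; have := leq_trans lt1 sF1; rewrite ltnS => /leq_trans; apply.
rewrite /A /B qE; move: (d) d2 D0 Ds; clear => e e2 D0 Ds.
have [s' ->] : exists s', s = (2 * D + s')%N by exists (s - 2 * D)%N; lia.
have -> : (2 * D + s' - D = D + s')%N by lia.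
have [d' ->] : exists d', e = d'.+2 by exists e.-2; lia.
have [D' ->] : exists D', D = D'.+1 by exists D.-1; lia.
rewrite /=; nia.
Qed.

End Stepanov.

(** * Frobenius orbits and divisors of monic polynomials *)

Section FrobeniusOrbits.
Variables (F : finFieldType) (K : closedFieldType) (iota : {rmorphism F -> K}).
Implicit Types (x y z : K) (g : {poly F}) (i j k n : nat).
Local Notation Q := #|F|.

Definition frobQ (x : K) : K := x ^+ Q.

Fact frobQ_zmod_morphism : zmod_morphism frobQ.
Proof.
move=> x y; rewrite /frobQ -[Q]expn1 (frobD iota) (frobN iota) //.
Qed.
Fact frobQ_monoid_morphism : monoid_morphism frobQ.
Proof. by split=> [|x y]; rewrite /frobQ ?expr1n ?exprMn. Qed.
HB.instance Definition _ :=
  GRing.isZmodMorphism.Build K K frobQ frobQ_zmod_morphism.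
HB.instance Definition _ :=
  GRing.isMonoidMorphism.Build K K frobQ frobQ_monoid_morphism.

Lemma finField_card_gt0 : (0 < Q)%N. Proof. exact: ltnW (finRing_gt1 F). Qed.

Lemma map_frobQ_iota g :
  map_poly frobQ (map_poly iota g) = map_poly iota g.
Proof.
by apply/polyP => i; rewrite !coef_map /= /frobQ -[Q]expn1 (frob_iota iota).
Qed.

(** For [j > 0] this lists the subfield of order [Q ^ j] inside [K], so no extension field has to be
    built as a type. For [j = 0] the polynomial is zero, whence the hypothesis [0 < j] below. *)
Definition fixed_seq j : seq K :=
  sval (closed_field_poly_normal ('X^(Q ^ j) - 'X : {poly K})).

Lemma fixed_seqE j : (0 < j)%N ->
  'X^(Q ^ j) - 'X = \prod_(z <- fixed_seq j) ('X - z%:P) :> {poly K}.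
Proof.
move=> j0; rewrite /fixed_seq; case: closed_field_poly_normal => rs /= {1}->.
have lt1 : (1 < Q ^ j)%N.
  by apply: leq_trans (finRing_gt1 F) _; rewrite -{1}(expn1 Q) leq_exp2l ?finRing_gt1.
by rewrite lead_coefDl ?lead_coefXn ?scale1r // size_polyN size_polyX size_polyXn ltnS.
Qed.

Lemma mem_fixed_seq j x : (0 < j)%N -> (x \in fixed_seq j) = (x ^+ (Q ^ j) == x).
Proof.
move=> j0; rewrite -root_prod_XsubC -fixed_seqE // /root !hornerE.
by rewrite subr_eq0.
Qed.

Lemma pcharf_card_expn j : (0 < j)%N -> (Q ^ j)%:R = 0 :> K.
Proof.
move=> j0.
have [p p_pr pF] := finPcharP F.
have pK : p \in [char K] by rewrite (fmorph_pchar iota).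
apply/eqP; rewrite -(dvdn_pcharf pK) Euclid_dvdX // j0 andbT.
have pQ : p.-nat Q by rewrite -cardsT; exact: pprimeChar_pgroup pF.
have [[|e] QE] := p_natP pQ; last by rewrite QE dvdn_exp.
by have := finRing_gt1 F; rewrite QE.
Qed.

Lemma fixed_seq_uniq j : (0 < j)%N -> uniq (fixed_seq j).
Proof.
move=> j0; rewrite -separable_prod_XsubC -fixed_seqE //.
rewrite unlock derivB derivXn derivX -mulr_natr -polyC_natr (pcharf_card_expn j0).
by rewrite polyC0 mulr0 sub0r -[- 1]scaleN1r coprimepZr ?oppr_eq0 ?oner_eq0 ?coprimep1.
Qed.

Lemma size_fixed_seq j : (0 < j)%N -> size (fixed_seq j) = (Q ^ j)%N.
Proof.
move=> j0; apply: succn_inj; rewrite -(size_prod_XsubC _ id) -fixed_seqE //.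
have lt1 : (1 < Q ^ j)%N.
  by apply: leq_trans (finRing_gt1 F) _; rewrite -{1}(expn1 Q) leq_exp2l ?finRing_gt1.
by rewrite size_polyDl size_polyXn // size_polyN size_polyX ltnS.
Qed.

(** When [x ^+ (Q ^ j) = x], this is the characteristic polynomial over [F] of [x] in the field of
    order [Q ^ j]: a power of its minimal polynomial. *)
Definition orbit_poly x j : {poly K} := \prod_(i < j) ('X - (x ^+ (Q ^ i))%:P).

Lemma orbit_poly_monic x j : orbit_poly x j \is monic.
Proof. by apply: monic_prod => i _; exact: monicXsubC. Qed.

Lemma size_orbit_poly x j : size (orbit_poly x j) = j.+1.
Proof.
rewrite /orbit_poly size_prod => [|i _]; last by rewrite polyXsubC_eq0.
rewrite (eq_bigr (fun=> 2%N)) => [|i _]; last by rewrite size_XsubC.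
rewrite sum_nat_const card_ord; lia.
Qed.

Lemma XsubC_dvd_orbit_poly x j : (0 < j)%N -> 'X - x%:P %| orbit_poly x j.
Proof.
by move=> j0; rewrite /orbit_poly (bigD1 (Ordinal j0)) //= expn0 expr1 dvdp_mulr.
Qed.

Lemma orbit_polyD x d j :
  orbit_poly x (d + j) = orbit_poly x d * orbit_poly (x ^+ (Q ^ d)) j.
Proof.
rewrite /orbit_poly big_split_ord /=; congr (_ * _).
by apply: eq_bigr => i _; rewrite expnD exprM.
Qed.

Lemma orbit_poly_period x d k : x ^+ (Q ^ d) = x ->
  orbit_poly x (k * d) = orbit_poly x d ^+ k.
Proof.
move=> xd; elim: k => [|k IH]; first by rewrite /orbit_poly mul0n big_ord0.
by rewrite mulSn orbit_polyD xd IH exprS.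
Qed.

Lemma map_frobQ_orbit_poly x j : (0 < j)%N -> x ^+ (Q ^ j) = x ->
  map_poly frobQ (orbit_poly x j) = orbit_poly x j.
Proof.
case: j => // j _ xj; rewrite /orbit_poly rmorph_prod /=.
transitivity (\prod_(i < j.+1) ('X - (x ^+ (Q ^ i.+1))%:P)).
  apply: eq_bigr => i _; rewrite map_polyXsubC /= /frobQ -exprM; congr ('X - (_ ^+ _)%:P).
  by rewrite expnSr.
by rewrite big_ord_recr [RHS]big_ord_recl /= xj mulrC expn0 expr1.
Qed.

(** Inverts [iota] coefficientwise. The default [0] is not met when [x ^+ (Q ^ j) = x]: Frobenius
    then permutes the factors, so it fixes the coefficients. *)
Definition orbit_polyF x j : {poly F} :=
  map_poly (fun y => odflt 0 [pick c | iota c == y]) (orbit_poly x j).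

Lemma map_orbit_polyF x j : (0 < j)%N -> x ^+ (Q ^ j) = x ->
  map_poly iota (orbit_polyF x j) = orbit_poly x j.
Proof.
move=> j0 xj; apply/polyP => i; rewrite coef_map /=.
have c0 : odflt 0 [pick c | iota c == 0] = 0.
  case: pickP => [c /eqP /= /eqP|/(_ 0)]; last by rewrite rmorph0 eqxx.
  by rewrite fmorph_eq0 => /eqP.
rewrite coef_map_id0 //.
have [|c cE] := @frob_fixed_iota _ _ iota (orbit_poly x j)`_i.
  by rewrite -[in RHS](map_frobQ_orbit_poly j0 xj) coef_map.
case: pickP => [c' /eqP //|/(_ c)]; by rewrite cE eqxx.
Qed.

Lemma orbit_polyF_monic x j : (0 < j)%N -> x ^+ (Q ^ j) = x ->
  orbit_polyF x j \is monic.
Proof.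
by move=> j0 xj; rewrite -(map_monic iota) map_orbit_polyF // orbit_poly_monic.
Qed.

Lemma size_orbit_polyF x j : (0 < j)%N -> x ^+ (Q ^ j) = x ->
  size (orbit_polyF x j) = j.+1.
Proof.
by move=> j0 xj; rewrite -(size_map_poly iota) map_orbit_polyF // size_orbit_poly.
Qed.

Lemma dvdp_XsubC_frob g z k i :
  ('X - z%:P) ^+ k %| map_poly iota g ->
  ('X - (z ^+ (Q ^ i))%:P) ^+ k %| map_poly iota g.
Proof.
elim: i => [|i IH]; first by rewrite expn0 expr1.
move=> /IH; rewrite -(dvdp_map frobQ) map_frobQ_iota rmorphXn /= map_polyXsubC /=.
by rewrite /frobQ -exprM expnSr.
Qed.

Lemma dvdp_prod_XsubCX (G : {poly K}) (s : seq K) k : uniq s ->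
  (forall y, y \in s -> ('X - y%:P) ^+ k %| G) ->
  (\prod_(y <- s) ('X - y%:P)) ^+ k %| G.
Proof.
elim: s => [|y s IH] /=; first by rewrite big_nil expr1n dvd1p.
case/andP => ys us sG; rewrite big_cons exprMn Gauss_dvdp.
  by rewrite sG ?mem_head // IH // => z zs; apply: sG; rewrite inE zs orbT.
rewrite coprimep_expl // coprimep_expr //.
by rewrite coprimep_sym coprimep_XsubC root_prod_XsubC.
Qed.

Lemma orbit_period z : (exists2 d, (0 < d)%N & z ^+ (Q ^ d) = z) ->
  exists d, [/\ (0 < d)%N, z ^+ (Q ^ d) = z,
    (forall j, (z ^+ (Q ^ j) == z) = (d %| j)%N) &
    uniq [seq z ^+ (Q ^ i) | i <- index_iota 0 d]].
Proof.
move=> [d0 d00 zd0].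
have ex : exists d, (0 < d)%N && (z ^+ (Q ^ d) == z) by exists d0; rewrite d00 zd0 eqxx.
case: (ex_minnP ex) => d /andP[dgt0 /eqP zd] dmin.
have zk k : z ^+ (Q ^ (k * d)) = z.
  by elim: k => [|k IH]; rewrite ?mul0n ?expn0 ?expr1 // mulSn expnD exprM zd.
have zlt j : (0 < j)%N -> (j < d)%N -> z ^+ (Q ^ j) != z.
  move=> j0 jd; apply/negP => zj; have := dmin j; rewrite j0 zj => /(_ isT).
  by rewrite leqNgt jd.
exists d; split=> // [j|].
  rewrite {1}(divn_eq j d) expnD exprM zk /dvdn.
  have [->|r0] := posnP (j %% d); first by rewrite expn0 expr1 !eqxx.
  by rewrite (negbTE (zlt _ r0 (ltn_pmod _ dgt0))).
rewrite map_inj_in_uniq ?iota_uniq // => i j; rewrite !mem_index_iota /=.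
wlog ij : i j / (i <= j)%N => [hw|].
  by move=> id jd e; case/orP: (leq_total i j) => le; [|apply/esym]; apply: hw.
move=> id jd; rewrite -{1}(subnKC ij) [(i + _)%N]addnC expnD exprM => /(frob_inj iota) /esym /eqP.
have [|r0] := posnP (j - i); first by move=> /eqP ji _; apply/eqP; rewrite eqn_leq ij -subn_eq0.
by rewrite (negbTE (zlt _ r0 (leq_ltn_trans (leq_subr _ _) jd))).
Qed.

(** If [d] is the period of [z], only the multiples [j = k * d] count, and [orbit_poly z (k * d)] is
    the [k]-th power of the minimal polynomial of [z]. It divides [g] exactly when [k] is at most
    the multiplicity of [z]. *)
Lemma count_orbit_divisors g (rs : seq K) z :
  map_poly iota g = \prod_(r <- rs) ('X - r%:P) -> z \in rs ->
  count (fun j => (z ^+ (Q ^ j) == z) && (orbit_poly z j %| map_poly iota g))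
    (index_iota 1 (size rs).+1) = count_mem z rs.
Proof.
set G := map_poly iota g => GE zrs.
have G0 : G != 0 by rewrite GE monic_neq0 ?monic_prod_XsubC.
have rootz i : z ^+ (Q ^ i) \in rs.
  rewrite -root_prod_XsubC -GE -dvdp_XsubCl -[X in X %| _]expr1.
  by apply: dvdp_XsubC_frob; rewrite expr1 -/G dvdp_XsubCl GE root_prod_XsubC.
(* The orbit of [z] stays inside the finite list [rs], so two of its points coincide, and Frobenius
   is injective. *)
have : exists2 d, (0 < d)%N & z ^+ (Q ^ d) = z.
  have : ~~ uniq [seq z ^+ (Q ^ i) | i <- index_iota 0 (size rs).+1].
    apply/negP => u; have sub : {subset [seq z ^+ (Q ^ i) | i <- index_iota 0 (size rs).+1] <= rs}.
      by move=> y /mapP[i _ ->]; exact: rootz.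
    by have := uniq_leq_size u sub; rewrite size_map size_iota subn0 ltnn.
  case/(uniqPn 0) => i [j [ij]]; rewrite size_map size_iota subn0 => jlt.
  rewrite !(nth_map 0%N) ?size_iota ?subn0 // ?(ltn_trans ij) //.
  rewrite !nth_iota ?subn0 // ?(ltn_trans ij) // !add0n.
  rewrite -{1}(subnKC (ltnW ij)) [(i + _)%N]addnC expnD exprM => /(frob_inj iota) zz.
  by exists (j - i)%N; rewrite -?zz // subn_gt0.
case/orbit_period => d [d0 zd zdvd zuniq].
have dvdG k : (orbit_poly z d ^+ k %| G) = (k <= count_mem z rs)%N.
  rewrite -mu_prod_XsubC -GE mup_geq //; apply/idP/idP => [|zk].
    by apply: dvdp_trans; apply: dvdp_exp2r; exact: XsubC_dvd_orbit_poly.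
  have -> : orbit_poly z d = \prod_(y <- [seq z ^+ (Q ^ i) | i <- index_iota 0 d]) ('X - y%:P).
    by rewrite big_map big_mkord.
  by apply: dvdp_prod_XsubCX => // y /mapP[i _ ->]; exact: dvdp_XsubC_frob.
rewrite -size_filter -[RHS](size_iota 1) -[RHS](size_map (muln^~ d)).
apply: perm_size; apply: uniq_perm.
- by rewrite filter_uniq ?iota_uniq.
- by rewrite map_inj_uniq ?iota_uniq // => a b /eqP; rewrite eqn_pmul2r // => /eqP.
move=> j; rewrite mem_filter mem_index_iota; apply/idP/mapP => [|[k]].
  case/andP => /andP[]; rewrite zdvd => /dvdnP[k ->]; rewrite orbit_poly_period // dvdG.
  rewrite muln_gt0 => kle /andP[/andP[k0 _] _].
  by exists k => //; rewrite mem_iota add1n ltnS k0.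
rewrite mem_iota add1n ltnS => /andP[k0 kle] ->.
rewrite zdvd dvdn_mull //= orbit_poly_period // dvdG kle /= muln_gt0 k0 d0 /= ltnS.
have := dvdp_leq G0 (_ : orbit_poly z (k * d) %| G).
rewrite size_orbit_poly GE size_prod_XsubC; apply.
by rewrite -GE orbit_poly_period // dvdG.
Qed.

Lemma sum_count_undup (T : eqType) (s : seq T) :
  (\sum_(z <- undup s) count_mem z s = size s)%N.
Proof.
under eq_bigr => z _ do rewrite -sum1_count big_mkcond /=.
rewrite exchange_big /= -[RHS]sum1_size !big_seq; apply: eq_bigr => y ys.
under eq_bigr => z _ do rewrite eq_sym.
by rewrite -big_mkcond sum1_count count_uniq_mem ?undup_uniq // mem_undup ys.
Qed.

(** The polynomial analogue of the identity that the von Mangoldt function summed over the divisors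
    of [n] gives [log n]: an irreducible factor [P] of multiplicity [e] contributes its [deg P]
    roots once for each of [P, ..., P^e]. *)
Lemma count_fixed_divisors n g : g \is monic -> size g = n.+1 ->
  (\sum_(1 <= j < n.+1) count (fun x => (orbit_polyF x j %| g)%R) (fixed_seq j) = n)%N.
Proof.
move=> gm sg; have [rs] := closed_field_poly_normal (map_poly iota g).
rewrite (monicP (_ : _ \is monic)) ?map_monic // scale1r => GE.
have srs : size rs = n.
  by apply: succn_inj; rewrite -(size_prod_XsubC _ id) -GE size_map_poly.
have cE j : (0 < j)%N -> count (fun x => (orbit_polyF x j %| g)%R) (fixed_seq j) =
   count (fun z => ((z ^+ (Q ^ j))%R == z) && (orbit_poly z j %| map_poly iota g)%R) (undup rs).
  move=> j0; rewrite -!size_filter; apply: perm_size; apply: uniq_perm.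
  - by rewrite filter_uniq ?fixed_seq_uniq.
  - by rewrite filter_uniq ?undup_uniq.
  move=> x; rewrite !mem_filter mem_undup mem_fixed_seq //.
  have [xj|] := eqVneq (x ^+ (Q ^ j)) x; rewrite ?andbF //= andbT.
  rewrite -(dvdp_map iota) map_orbit_polyF //.
  case: (boolP (_ %| _)) => //= dv; apply/esym; rewrite -root_prod_XsubC -GE.
  by rewrite -dvdp_XsubCl; apply: dvdp_trans dv; exact: XsubC_dvd_orbit_poly.
rewrite big_nat (eq_bigr (fun j => \sum_(z <- undup rs)
   (((z ^+ (Q ^ j))%R == z) && (orbit_poly z j %| map_poly iota g)%R : nat))%N); last first.
  by move=> j /andP[j0 _]; rewrite cE // -sum1_count big_mkcond.
rewrite -big_nat exchange_big /= -[RHS]srs -[RHS]sum_count_undup.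
rewrite !big_seq; apply: eq_bigr => z; rewrite mem_undup => zrs.
by rewrite -(count_orbit_divisors GE zrs) -sum1_count srs [RHS]big_mkcond.
Qed.

End FrobeniusOrbits.

(** * L-series coefficients and Newton's identities *)

Section EulerProduct.
Variables (F : finFieldType) (K : closedFieldType) (iota : {rmorphism F -> K}).
Variables (C : comNzRingType) (lam : {poly F} -> C).
Hypothesis lamM : forall g h, lam (g * h) = lam g * lam h.
Implicit Types (g h : {poly F}) (j n : nat).

(** Indexing by the lower coefficients makes the monic polynomials of degree [n] a finite type. *)
Definition monic_of n (v : 'rV[F]_n) : {poly F} := 'X^n + rVpoly v.

Lemma size_monic_of n (v : 'rV[F]_n) : size (monic_of v) = n.+1.
Proof.
by rewrite size_polyDl size_polyXn // ltnS size_poly.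
Qed.

Lemma monic_monic_of n (v : 'rV[F]_n) : monic_of v \is monic.
Proof.
by rewrite monicE lead_coefDl ?lead_coefXn // size_polyXn ltnS size_poly.
Qed.

Lemma monic_ofK n g : g \is monic -> size g = n.+1 ->
  monic_of (poly_rV (g - 'X^n) : 'rV[F]_n) = g.
Proof.
move=> gm sg; rewrite /monic_of poly_rV_K; first by rewrite addrC subrK.
apply/leq_sizeP => k; rewrite leq_eqVlt coefB coefXn => /orP[/eqP <-|nk].
  by move/monicP: gm; rewrite lead_coefE sg /= => ->; rewrite eqxx subrr.
by rewrite nth_default ?sg // gtn_eqF // subrr.
Qed.

Lemma monic_of_inj n : injective (@monic_of n).
Proof. by move=> v w /addrI /(can_inj rVpolyK). Qed.

Definition Lcoef n : C := \sum_(v : 'rV[F]_n) lam (monic_of v).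

(** For [lam = node_char] this is the character sum over the extension of degree [j], with [chi]
    composed with the norm: the characteristic polynomial of [x] takes at a point [a] of [F] the
    norm of [a - x] as value. *)
Definition frob_charsum j : C :=
  \sum_(x <- fixed_seq F K j) lam (orbit_polyF iota x j).

Lemma lam_mul_Lcoef n j h : h \is monic -> size h = j.+1 -> (j <= n)%N ->
  lam h * Lcoef (n - j) =
  \sum_(v : 'rV[F]_n | h %| monic_of v) lam (monic_of v).
Proof.
move=> hm sh jn.
have h0 : h != 0 by rewrite monic_neq0.
pose up (w : 'rV[F]_(n - j)) : 'rV[F]_n := poly_rV (h * monic_of w - 'X^n).
pose dn (v : 'rV[F]_n) : 'rV[F]_(n - j) := poly_rV (monic_of v %/ h - 'X^(n - j)).
have upE w : monic_of (up w) = h * monic_of w.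
  apply: monic_ofK; first by rewrite monicMl ?monic_monic_of.
  by rewrite size_monicM ?monic_neq0 ?monic_monic_of // sh size_monic_of addSn /= addnS subnKC.
have dnK w : dn (up w) = w.
  apply: monic_of_inj; rewrite /dn upE mulrC mulpK // monic_ofK ?monic_monic_of //.
  exact: size_monic_of.
rewrite (reindex_onto up dn) => [|v hv]; last first.
  have sv := divpK hv.
  have qm : monic_of v %/ h \is monic.
    by have := monic_monic_of v; rewrite -{1}sv monicMr.
  apply: monic_of_inj; rewrite upE mulrC monic_ofK //.
  by rewrite size_divp // size_monic_of sh subSn.
rewrite /Lcoef big_distrr /=; apply: eq_big => [w|w _]; last by rewrite upE lamM.
by rewrite upE dvdp_mulr ?dvdpp //= dnK eqxx.
Qed.

(** The logarithmic derivative of the Euler product, coefficient by coefficient. The weight [n] of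
    each monic polynomial is written as the count of [count_fixed_divisors]; exchanging the sums
    leaves the multiples of each orbit polynomial, which [lam_mul_Lcoef] evaluates. *)
Lemma newton_Lcoef n :
  Lcoef n *+ n = \sum_(1 <= j < n.+1) frob_charsum j * Lcoef (n - j).
Proof.
transitivity (\sum_(1 <= j < n.+1) \sum_(x <- fixed_seq F K j)
    \sum_(v : 'rV[F]_n | orbit_polyF iota x j %| monic_of v) lam (monic_of v)); last first.
  rewrite !big_nat; apply: eq_bigr => j /andP[j0 jn].
  rewrite /frob_charsum mulr_suml !big_seq; apply: eq_bigr => x.
  rewrite mem_fixed_seq // => /eqP xj.
  by rewrite (lam_mul_Lcoef (n := n) (j := j)) // ?orbit_polyF_monic ?size_orbit_polyF.
under eq_bigr => j _ do under eq_bigr => x _ do rewrite big_mkcond /=.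
under eq_bigr => j _ do rewrite exchange_big /=.
rewrite exchange_big /= /Lcoef -sumrMnl; apply: eq_bigr => v _.
have cnt := count_fixed_divisors iota (monic_monic_of v) (size_monic_of v).
rewrite -[X in _ *+ X]cnt -sumrMnr; apply: eq_bigr => j _.
by rewrite -big_mkcond /= -sum1_count -sumrMnr.
Qed.

End EulerProduct.

(** * Power sums and inverse roots *)

Section PowerSums.
Variable C : closedFieldType.
Implicit Types (ws : seq C) (A S : nat -> C).

Lemma newton_unique A S S' : A 0 = 1 ->
  (forall n, A n *+ n = \sum_(1 <= j < n.+1) S j * A (n - j)%N) ->
  (forall n, A n *+ n = \sum_(1 <= j < n.+1) S' j * A (n - j)%N) ->
  forall n, (0 < n)%N -> S n = S' n.
Proof.
move=> A0 hS hS' n; elim/ltn_ind: n => n IH n0.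
have := hS n; rewrite hS' big_nat_recr //= [in RHS]big_nat_recr //= subnn A0 !mulr1.
rewrite [X in X + _ = _]big_nat [X in _ = X + _]big_nat (eq_bigr (fun j => S j * A (n - j)%N)).
  by move/addrI.
by move=> j /andP[j0 jn]; rewrite IH.
Qed.

Lemma newton_prod ws n :
  let L : {poly C} := \prod_(w <- ws) (1 - w *: 'X) in
  L`_n *+ n = \sum_(1 <= j < n.+1) (- \sum_(w <- ws) w ^+ j) * L`_(n - j).
Proof.
elim: ws n => [|w ws IH] n /=.
  rewrite big_nil coef1; case: n => [|n]; first by rewrite big_geq.
  by rewrite mul0rn big1 // => j _; rewrite big_nil oppr0 mul0r.
rewrite big_cons; set L := \prod_(w <- ws) _ in IH *.
case: n => [|n]; first by rewrite big_geq.
(* The coefficients of ['X * L], with the vanishing one at index [0] built in. *)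
pose L' k := if k is k'.+1 then L`_k' else 0.
have cE k : ((1 - w *: 'X) * L)`_k = L`_k - w * L' k.
  rewrite mulrBl mul1r coefB -scalerAl coefZ coefXM.
  by case: k.
rewrite cE /=.
have -> : \sum_(1 <= j < n.+2) (- \sum_(w0 <- w :: ws) w0 ^+ j) * ((1 - w *: 'X) * L)`_(n.+1 - j)
  = \sum_(1 <= j < n.+2) (- \sum_(w0 <- ws) w0 ^+ j) * L`_(n.+1 - j)
   - w * (\sum_(1 <= j < n.+2) (- \sum_(w0 <- ws) w0 ^+ j) * L' (n.+1 - j)%N)
   - \sum_(1 <= j < n.+2) (w ^+ j * L`_(n.+1 - j) - w ^+ j.+1 * L' (n.+1 - j)%N).
  rewrite mulr_sumr -!sumrB; apply: eq_bigr => j _; rewrite cE big_cons exprS.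
  ring.
rewrite -IH.
have -> : \sum_(1 <= j < n.+2) (- \sum_(w0 <- ws) w0 ^+ j) * L' (n.+1 - j)%N = L`_n *+ n.
  rewrite IH big_nat_recr //= subnn mulr0 addr0 !big_nat.
  by apply: eq_bigr => j /andP[j0 jn]; rewrite subSn // -ltnS.
have -> : \sum_(1 <= j < n.+2) (w ^+ j * L`_(n.+1 - j) - w ^+ j.+1 * L' (n.+1 - j)%N)
  = w * L`_n.
  pose u j := w ^+ j * L' (n.+2 - j)%N.
  rewrite big_nat (eq_bigr (fun j => u j - u j.+1)) => [|j /andP[j0 jn]]; last first.
    by rewrite /u subSS [in RHS]subSn.
  rewrite -big_nat -[LHS]opprK -sumrN (eq_bigr (fun j => u j.+1 - u j)).
    by rewrite telescope_sumr // /u subnn /= mulr0 sub0r opprK expr1.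
  by move=> j _; rewrite opprB.
by rewrite mulrnBl -addrA -opprD -mulrDr -mulrSr mulrnAr.
Qed.

Lemma poly_inverse_roots (L : {poly C}) : L`_0 = 1 ->
  exists ws, L = \prod_(w <- ws) (1 - w *: 'X) /\ (size ws < size L)%N.
Proof.
move=> L0; have [zs LE] := closed_field_poly_normal L.
have Ln0 : L != 0 by apply/eqP => L0'; move: L0; rewrite L0' coef0 => /esym/eqP; rewrite oner_eq0.
have z0 z : z \in zs -> z != 0.
  move=> zzs; apply/eqP => zE; have : root L z.
    by rewrite LE rootZ ?lead_coef_eq0 // root_prod_XsubC.
  by rewrite zE /root horner_coef0 L0 oner_eq0.
have szs : size zs = (size L).-1.
  by rewrite LE size_scale ?lead_coef_eq0 // size_prod_XsubC.
exists (map (@GRing.inv C) zs); rewrite size_map szs; split; last first.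
  by rewrite prednK ?size_poly_gt0.
have E : \prod_(w <- map (@GRing.inv C) zs) (1 - w *: 'X) =
   (\prod_(z <- zs) - z^-1) *: \prod_(z <- zs) ('X - z%:P) :> {poly C}.
  rewrite big_map -mul_polyC rmorph_prod -big_split /= !big_seq.
  apply: eq_bigr => z zzs; rewrite mul_polyC scalerBr !scaleNr opprK.
  by rewrite -mul_polyC -[(_ *: z%:P)]mul_polyC -polyCM mulVf ?z0 // addrC mul_polyC.
have E0 : (\prod_(w <- map (@GRing.inv C) zs) (1 - w *: 'X))`_0 = 1 :> C.
  rewrite -horner_coef0 horner_prod big1 // => w _.
  by rewrite hornerD hornerN hornerZ hornerX mulr0 subr0 -polyC1 hornerC.
move: E0; rewrite E {1}LE coefZ; move: L0; rewrite {1}LE coefZ => L0 E0.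
congr (_ *: _); have nz : (\prod_(z <- zs) ('X - z%:P))`_0 != 0 :> C.
  by apply/eqP => e; move: L0; rewrite e mulr0 => /esym/eqP; rewrite oner_eq0.
by apply: (mulIf nz); rewrite L0 E0.
Qed.

End PowerSums.

Section PowerSumGrowth.
Variable C : numFieldType.
Hypothesis archi : forall x : C, 0 <= x -> exists n : nat, x < n%:R.

(** By Bernoulli's inequality the powers of [t > 1] grow at least linearly, and the archimedean
    hypothesis makes linear growth unbounded. *)
Lemma exprn_bounded_le1 (t M : C) (r0 : nat) : 0 <= t ->
  (forall r, (r0 <= r)%N -> t ^+ r <= M) -> t <= 1.
Proof.
move=> t0 tM; rewrite real_leNgt ?ger0_real ?ler01 //; apply/negP => t1.
have bern r : 1 + r%:R * (t - 1) <= t ^+ r.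
  elim: r => [|r IH]; first by rewrite mul0r addr0.
  rewrite exprS; apply: le_trans (_ : t * (1 + r%:R * (t - 1)) <= _); last first.
    by rewrite ler_wpM2l.
  rewrite -subr_ge0 -natr1.
  have -> : t * (1 + r%:R * (t - 1)) - (1 + (r%:R + 1) * (t - 1)) = r%:R * (t - 1) ^+ 2.
    by ring.
  by rewrite mulr_ge0 // exprn_ge0 // subr_ge0 ltW.
have M0 : 0 <= M by apply: le_trans (tM r0 (leqnn _)); rewrite exprn_ge0.
have d0 : 0 < t - 1 by rewrite subr_gt0.
have [n nM] := archi (divr_ge0 M0 (ltW d0)).
have := tM (r0 + n)%N (leq_addr _ _); apply/negP.
rewrite -real_ltNge ?ger0_real ?exprn_ge0 //; apply: lt_le_trans (bern _).
rewrite natrD mulrDl addrA; apply: ltr_wpDl.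
  by rewrite addr_ge0 // mulr_ge0 // ltW.
by rewrite -ltr_pdivrMr.
Qed.

(** Cancellation between the [z ^+ r] is ruled out by a filter: with [q] vanishing at all other
    values in [zs], the combination of the power sums of index [r + k] with weights [q_k] is a
    nonzero constant times [z ^+ r]. Hence [(|z| / B) ^ r] stays bounded. *)
Lemma power_sum_growth (zs : seq C) (B M : C) (r0 : nat) : 0 < B ->
  (forall r, (r0 <= r)%N -> `|\sum_(z <- zs) z ^+ r| <= M * B ^+ r) ->
  forall z, z \in zs -> `|z| <= B.
Proof.
move=> B0 hM z zzs.
pose q : {poly C} := \prod_(y <- undup zs | y != z) ('X - y%:P).
have qz : q.[z] != 0.
  rewrite horner_prod prodf_seq_neq0; apply/allP => y _; apply/implyP => yz.
  by rewrite !hornerE subr_eq0 eq_sym.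
have qy y : y \in zs -> y != z -> q.[y] = 0.
  move=> yzs yz; apply/eqP; rewrite horner_prod prodf_seq_eq0; apply/hasP.
  by exists y; rewrite ?mem_undup // yz /= !hornerE subrr.
pose c := (count_mem z zs)%:R * q.[z].
have c0 : 0 < `|c|.
  rewrite normr_gt0 mulf_neq0 // pnatr_eq0 -lt0n -has_count.
  by apply/hasP; exists z => /=.
have key r : c * z ^+ r = \sum_(k < size q) q`_k * \sum_(y <- zs) y ^+ (r + k).
  under eq_bigr => k _ do rewrite mulr_sumr.
  rewrite exchange_big /=.
  transitivity (\sum_(y <- zs) if y == z then q.[z] * z ^+ r else 0).
    by rewrite -big_mkcond /= big_const_seq iter_addr_0 /c mulr_natl mulrnAl.
  rewrite !big_seq; apply: eq_bigr => y yzs.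
  have -> : \sum_(k < size q) q`_k * y ^+ (r + k) = q.[y] * y ^+ r.
    rewrite horner_coef mulr_suml; apply: eq_bigr => k _.
    by rewrite exprD mulrAC mulrA.
  have [->//|yz] := eqVneq y z.
  by rewrite qy // mul0r.
pose M' := (\sum_(k < size q) `|q`_k| * (M * B ^+ k)) / `|c|.
have bd r : (r0 <= r)%N -> (`|z| / B) ^+ r <= M'.
  move=> rr; rewrite expr_div_n ler_pdivrMr ?exprn_gt0 // /M' mulrAC ler_pdivlMr //.
  rewrite mulrC -normrX -normrM key (le_trans (ler_norm_sum _ _ _)) // mulr_suml.
  apply: ler_sum => k _; rewrite normrM -!mulrA ler_wpM2l //.
  by rewrite -exprD [(k + r)%N]addnC hM // (leq_trans rr) ?leq_addr.
have := exprn_bounded_le1 (divr_ge0 (normr_ge0 z) (ltW B0)) bd.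
by rewrite ler_pdivrMr // mul1r.
Qed.

End PowerSumGrowth.

(** * The L-polynomial of a product of characters *)

Section CharacterPolynomials.
Variables (F : finFieldType) (C : fieldType) (chi : F -> C).
Hypotheses (chi1 : chi 1 = 1) (chiM : forall x y, chi (x * y) = chi x * chi y).
Variables (I : finType) (c : I -> F) (e : I -> nat).

(** At [g = 'X - u] this is the summand of [weil_bound], so the complete sum there is the first
    power sum. *)
Definition node_char (g : {poly F}) : C := \prod_i chi g.[c i] ^+ e i.

Lemma chiX x n : chi (x ^+ n) = chi x ^+ n.
Proof. by elim: n => [|n IH]; rewrite ?expr0 // !exprS chiM IH. Qed.

Lemma chi_prod (J : Type) (s : seq J) (P : pred J) (h : J -> F) :
  chi (\prod_(j <- s | P j) h j) = \prod_(j <- s | P j) chi (h j).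
Proof. exact: (big_morph chi chiM chi1). Qed.

Lemma node_charM g h : node_char (g * h) = node_char g * node_char h.
Proof.
by rewrite /node_char -big_split; apply: eq_bigr => i _; rewrite hornerM chiM exprMn.
Qed.

Lemma node_charE g : node_char g = chi (\prod_i g.[c i] ^+ e i).
Proof. by rewrite chi_prod; apply: eq_bigr => i _; rewrite chiX. Qed.

(* Multiplying the value at [c0] by [u] and keeping the values at the other
   nodes permutes the monic polynomials of degree [n]. *)
Lemma Lcoef_node_char_eq0 n (c0 u : F) : u != 0 ->
  chi u ^+ (\sum_(i | c i == c0) e i) != 1 -> (#|I| <= n)%N ->
  Lcoef node_char n = 0.
Proof.
move=> u0 chiu In.
(* Adding a multiple of [lag] changes the value at [c0] only. Some index lies at [c0], so [lag] has
   degree below [#|I| <= n] and the leading term is kept. *)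
pose lag : {poly F} := \prod_(i | c i != c0) ('X - (c i)%:P).
have szlag : (size lag <= n)%N.
  rewrite /lag size_prod => [|i _]; last by rewrite polyXsubC_eq0.
  rewrite (eq_bigr (fun=> 2%N)) => [|i _]; last by rewrite size_XsubC.
  rewrite sum_nat_const.
  have ex : exists i, c i == c0.
    apply/existsP; apply: contraNT chiu => /existsPn nex.
    by rewrite big_pred0 ?expr0 // => i; apply: negbTE.
  have : (#|(fun i => c i != c0)| < #|I|)%N.
    case: ex => i ci; rewrite -(cardC (fun i => c i != c0)) -[ltnLHS]addn0.
    by rewrite ltn_add2l; apply/card_gt0P; exists i; rewrite !inE /in_mem /= negbK.
  have dbl (x : nat) : ((x * 2).+1 - x = x.+1)%N by lia.
  by move=> lt1; rewrite dbl; exact: leq_trans lt1 In.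
have lag0 : lag.[c0] != 0.
  rewrite horner_prod; apply/prodf_neq0 => i ci.
  by rewrite !hornerE subr_eq0 eq_sym.
have lagi i : c i != c0 -> lag.[c i] = 0.
  move=> ci; apply/eqP; rewrite horner_prod; apply/prodf_eq0.
  by exists i => //; rewrite !hornerE subrr.
pose phi (v : 'rV[F]_n) :=
  v + ((u - 1) * (monic_of v).[c0] / lag.[c0]) *: (poly_rV lag : 'rV[F]_n).
have phiE v : monic_of (phi v) =
    monic_of v + ((u - 1) * (monic_of v).[c0] / lag.[c0]) *: lag.
  by rewrite /monic_of /phi linearD linearZ /= poly_rV_K // addrA.
have phi0 v : (monic_of (phi v)).[c0] = u * (monic_of v).[c0].
  by rewrite phiE hornerD hornerZ divfK // mulrBl mul1r addrC subrK.
have phii v i : c i != c0 -> (monic_of (phi v)).[c i] = (monic_of v).[c i].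
  by move=> ci; rewrite phiE hornerD hornerZ lagi // mulr0 addr0.
have phi_inj : injective phi.
  move=> v w vw; have := phi0 v; rewrite vw phi0 => /(mulfI u0) e0.
  by move: vw; rewrite /phi e0 => /addIr.
have phi_char v : node_char (monic_of (phi v)) =
    chi u ^+ (\sum_(i | c i == c0) e i) * node_char (monic_of v).
  rewrite /node_char (bigID (fun i => c i == c0)) /=.
  rewrite [X in _ = _ * X](bigID (fun i => c i == c0)) /=.
  rewrite mulrA; congr (_ * _); last by apply: eq_bigr => i ci; rewrite phii.
  rewrite -prodrXr -big_split /=; apply: eq_bigr => i /eqP ->.
  by rewrite phi0 chiM exprMn.
have : Lcoef node_char n = chi u ^+ (\sum_(i | c i == c0) e i) * Lcoef node_char n.
  by rewrite {1}/Lcoef (reindex_inj phi_inj) mulr_sumr; apply: eq_bigr => v _.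
move/eqP; rewrite -subr_eq0 -{1}[Lcoef _ _]mul1r -mulrBl mulf_eq0 subr_eq0 eq_sym.
by rewrite (negbTE chiu) => /eqP.
Qed.

End CharacterPolynomials.

(** * Weil's bound *)

Section WeilBound.
Variables (F : finFieldType) (C : numClosedFieldType) (chi : F -> C).
Hypothesis archi : forall x : C, 0 <= x -> exists n : nat, x < n%:R.
Hypotheses (chi0 : chi 0 = 0) (chi1 : chi 1 = 1).
Hypothesis chiM : forall x y, chi (x * y) = chi x * chi y.
Hypothesis chi_nontriv : exists2 u, u != 0 & chi u != 1.
Local Notation Q := #|F|.

Lemma finField_card_gt2 : (2 < Q)%N.
Proof.
case: chi_nontriv => u u0 chiu; rewrite ltn_neqAle finRing_gt1 andbT.
apply/eqP => Q2; have := expf_card u; rewrite -Q2 => uu.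
by move: chiu; rewrite (_ : u = 1) ?chi1 ?eqxx //; apply: (mulfI u0); rewrite mulr1.
Qed.

Lemma expf_card_pred (x : F) : x != 0 -> x ^+ Q.-1 = 1.
Proof.
move=> x0; apply: (mulfI x0); rewrite -exprS prednK ?expf_card ?mulr1 //.
exact: finField_card_gt0.
Qed.

Lemma norm_chi x : x != 0 -> `|chi x| = 1.
Proof.
move=> x0; apply/eqP; rewrite -(@pexpr_eq1 _ _ Q.-1) //; last first.
  by have := finField_card_gt2; lia.
by rewrite -normrX -chiX // expf_card_pred // chi1 normr1.
Qed.

Lemma sum_chi : \sum_(x | x != 0) chi x = 0.
Proof.
case: chi_nontriv => u u0 chiu.
have : \sum_(x | x != 0) chi x = chi u * \sum_(x | x != 0) chi x.
  rewrite [LHS](reindex_inj (mulfI u0)) mulr_sumr; apply: eq_big => [x|x _]; last by rewrite chiM.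
  by rewrite mulf_eq0 (negbTE u0).
move/eqP; rewrite -subr_eq0 -{1}[\sum_(_ | _) _]mul1r -mulrBl mulf_eq0 subr_eq0 eq_sym.
by rewrite (negbTE chiu) => /eqP.
Qed.

Variables (I : finType) (c : I -> F) (e : I -> nat).
Local Notation D := (\sum_i e i)%N.
Hypothesis copD : coprime D Q.-1.

Lemma degree_gt0 : (0 < D)%N.
Proof.
rewrite lt0n; apply/eqP => D0; have := finField_card_gt2.
by move: copD; rewrite D0 /coprime gcd0n => /eqP; lia.
Qed.

(** Nodes may coincide, so the exponent of a node is the sum over its indices. If it were trivial at
    every node, then [chi u ^+ D = 1]; together with [chi u ^+ Q.-1 = 1] and coprimality this gives
    [chi u = 1]. *)
Lemma exists_nontriv_node :
  exists c0 u, u != 0 /\ chi u ^+ (\sum_(i | c i == c0) e i)%N != 1.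
Proof.
case: chi_nontriv => u u0 chiu.
case: (boolP [exists c0, chi u ^+ (\sum_(i | c i == c0) e i)%N != 1]) => [/existsP[c0 h]|].
  by exists c0, u.
move/existsPn => h; exfalso; move/negP: chiu; apply.
have uD : chi u ^+ D = 1.
  rewrite (partition_big c predT) //= -prodrXr big1 // => c0 _.
  by have := h c0; rewrite negbK => /eqP.
have uQ : chi u ^+ Q.-1 = 1 by rewrite -chiX // expf_card_pred.
have [[a b] /= ab] := coprimeP _ degree_gt0 copD.
have abE : (a * D = b * Q.-1 + 1)%N.
  by rewrite addnC -ab subnK // ltnW // -subn_gt0 ab.
have := congr1 (fun n => chi u ^+ n) abE.
by rewrite exprD mulnC exprM uD expr1n mulnC exprM uQ expr1n mul1r expr1 => <-.
Qed.

Section Closure.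
Variables (K : closedFieldType) (iota : {rmorphism F -> K}).

Let lam := node_char chi c e.
Let f : {poly F} := \prod_i ((c i)%:P - 'X) ^+ e i.

Lemma size_node_poly : size f = D.+1.
Proof.
have nz i : (c i)%:P - 'X != 0 :> {poly F} by rewrite -opprB oppr_eq0 polyXsubC_eq0.
have sz1 i : size ((c i)%:P - 'X) = 2 by rewrite -opprB size_polyN size_XsubC.
have sz i : size (((c i)%:P - 'X) ^+ e i) = (e i).+1.
  rewrite -[LHS]prednK ?size_poly_gt0 ?expf_neq0 //.
  by rewrite size_exp sz1 mul1n.
rewrite /f size_prod => [|i _]; last by rewrite expf_neq0.
under eq_bigr => i _ do rewrite sz -addn1.
by rewrite big_split /= sum1_card; lia.
Qed.

Lemma orbit_polyF_horner x j a : (0 < j)%N -> x ^+ (Q ^ j) = x ->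
  iota (orbit_polyF iota x j).[a] = (iota a - x) ^+ (\sum_(i < j) Q ^ i)%N.
Proof.
move=> j0 xj; rewrite -horner_map /= map_orbit_polyF // horner_prod -prodrXr.
apply: eq_bigr => i _; rewrite !hornerE (frobD iota) (frobN iota).
by rewrite (frob_iota iota).
Qed.

Lemma iota_orbit_node x j : (0 < j)%N -> x ^+ (Q ^ j) = x ->
  iota (\prod_i (orbit_polyF iota x j).[c i] ^+ e i) =
  (map_poly iota f).[x] ^+ (\sum_(i < j) Q ^ i)%N.
Proof.
move=> j0 xj; rewrite rmorph_prod /f rmorph_prod /= horner_prod -prodrXl.
apply: eq_bigr => i _; rewrite !rmorphXn /= orbit_polyF_horner //.
by rewrite rmorphB /= map_polyX map_polyC !hornerE -!exprM mulnC.
Qed.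

(** [N a] counts the points of norm [a], and Stepanov bounds each by the same [B]. Since [chi] sums
    to zero, [N a] may be replaced by [N a - B], which has constant sign; the sum is then at most
    [(Q - 1) * B] minus the total number of points, and the terms of order [q * q] cancel. *)
Lemma frob_charsum_even r : (2 * D <= r)%N ->
  `|frob_charsum iota lam (r + r)| <= (Q.-1 * (3 * D + 1) + D)%:R * (Q ^ r)%:R.
Proof.
move=> Dr.
have Q2 := finField_card_gt2.
have D0 := degree_gt0.
have rr0 : (0 < r + r)%N by lia.
pose s := (\sum_(i < r) Q ^ i)%N; pose q := (Q ^ r)%N.
have qE : q = (Q.-1 * s).+1.
  by rewrite -predn_exp prednK // expn_gt0 (ltnW (finRing_gt1 F)).
have sE : (\sum_(i < r + r) Q ^ i = s * q.+1)%N.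
  rewrite big_split_ord /= mulnS; congr (_ + _)%N; rewrite mulnC big_distrr /=.
  by apply: eq_bigr => i _; rewrite expnD.
have rs : (r <= s)%N.
  rewrite -[leqLHS]card_ord -sum1_card; apply: leq_sum => i _.
  by rewrite expn_gt0 (ltnW (finRing_gt1 F)).
pose xs := fixed_seq F K (r + r).
pose W x := \prod_i (orbit_polyF iota x (r + r)).[c i] ^+ e i.
have WE x : x \in xs -> iota (W x) = (map_poly iota f).[x] ^+ (s * q.+1).
  by rewrite mem_fixed_seq // => /eqP xj; rewrite iota_orbit_node // sE.
pose N a := count (fun x => W x == a) xs.
have SE : frob_charsum iota lam (r + r) = \sum_(a | a != 0) chi a * (N a)%:R.
  rewrite /frob_charsum (eq_bigr (fun x => chi (W x))) => [|x _]; last exact: node_charE.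
  have -> : \sum_(x <- xs) chi (W x) = \sum_a \sum_(x <- xs | W x == a) chi a.
    rewrite [RHS](exchange_big_dep predT) //=; apply: eq_bigr => x _.
    by rewrite (big_pred1 (W x)) // => a; rewrite /= eq_sym.
  rewrite (bigD1 0) //= chi0 big1 ?add0r //; apply: eq_bigr => a _.
  by rewrite big_const_seq iter_addr_0 mulr_natr.
have NB a : a != 0 -> (N a <= q * (s + 3 * D + 1))%N.
  move=> a0; rewrite /N -size_filter.
  apply: (stepanov_bound (iota := iota) (f := f) (a := a)) => //.
  - exact: size_node_poly.
  - exact: leq_trans Dr rs.
  - by rewrite filter_uniq // fixed_seq_uniq.
  move=> x; rewrite mem_filter => /andP[/eqP Wx xxs]; rewrite -WE // Wx; split=> //.
  by move: xxs; rewrite mem_fixed_seq // -expnD => /eqP.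
have N0 : (N 0%R <= D)%N.
  have f0 : map_poly iota f != 0.
    by rewrite map_poly_eq0 -size_poly_gt0 size_node_poly.
  rewrite -ltnS -size_node_poly -(size_map_poly iota) /N -size_filter.
  apply: max_poly_roots => //; last by rewrite filter_uniq // fixed_seq_uniq.
  apply/allP => x; rewrite mem_filter => /andP[/eqP Wx xxs].
  by have := WE x xxs; rewrite Wx rmorph0 => /esym/eqP; rewrite expf_eq0 => /andP[].
have sumN : (\sum_(a | a != 0%R) N a + N 0%R = q * q)%N.
  have : (\sum_a N a = q * q)%N.
    rewrite -expnD -(size_fixed_seq F K rr0) -sum1_size.
    under eq_bigr => a _ do rewrite /N -sum1_count.
    rewrite (exchange_big_dep predT) //=; apply: eq_bigr => x _.
    by rewrite (eq_bigl (pred1 (W x))) ?big_pred1_eq // => a; rewrite /= eq_sym.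
  by rewrite (bigD1 0) //= addnC.
pose B := (q * (s + 3 * D + 1))%N.
have -> : frob_charsum iota lam (r + r) = \sum_(a | a != 0) chi a * ((N a)%:R - B%:R).
  under [RHS]eq_bigr => a _ do rewrite mulrBr.
  by rewrite sumrB -mulr_suml sum_chi mul0r subr0.
apply: (le_trans (ler_norm_sum _ _ _)).
rewrite (eq_bigr (fun a => B%:R - (N a)%:R)) => [|a a0]; last first.
  by rewrite normrM norm_chi // mul1r distrC ger0_norm // subr_ge0 ler_nat NB.
rewrite sumrB sumr_const -natr_sum.
have -> : #|[pred a : F | a != 0]| = Q.-1.
  by rewrite (cardC1 (0 : F)).
rewrite -mulrnA lerBlDr -natrM -natrD ler_nat -/q.
rewrite /B; move: (N 0) (\sum_(a | a != 0%R) N a)%N N0 sumN qE.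
move: (q) (Q.-1) (s) D; clear => q Q s D n0 n N0 sumN qE.
nia.
Qed.

End Closure.

Theorem weil_bound :
  `|\sum_u \prod_i chi (c i - u) ^+ e i| <= #|I|%:R * sqrtC Q%:R.
Proof.
have [K [iota _]] := countable_algebraic_closure F.
pose lam := node_char chi c e.
pose A := Lcoef lam; pose S := frob_charsum iota lam.
have A0 : A 0%N = 1.
  rewrite /A /Lcoef (big_pred1 0) => [|v]; last by rewrite /= [v]thinmx0 eqxx.
  rewrite /monic_of linear0 addr0 expr0 /lam /node_char big1 // => i _.
  by rewrite -polyC1 hornerC chi1 expr1n.
have [c0 [u0 [u0n0 chiu0]]] := exists_nontriv_node.
(* The truncation loses nothing, as the coefficients vanish from [#|I|] on; the number of inverse
   roots, hence the factor [#|I|] of the bound, comes from here. *)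
pose L : {poly C} := \poly_(n < #|I|) A n.
have LE n : L`_n = A n.
  rewrite coef_poly; case: ltnP => // In.
  by rewrite /A (Lcoef_node_char_eq0 chiM u0n0 chiu0 In).
have [ws [Lws szws]] : exists ws, L = \prod_(w <- ws) (1 - w *: 'X) /\ (size ws < size L)%N.
  by apply: poly_inverse_roots; rewrite LE.
have SE : forall n, (0 < n)%N -> S n = - \sum_(w <- ws) w ^+ n.
  apply: (@newton_unique _ A S (fun n => - \sum_(w <- ws) w ^+ n) A0) => n.
    exact: newton_Lcoef (node_charM chiM c e) n.
  rewrite -LE Lws newton_prod -Lws; apply: eq_bigr => j _; by rewrite LE.
have wsQ w : w \in ws -> `|w| <= sqrtC Q%:R.
  move=> wws; have Q0 : 0 < Q%:R :> C by rewrite ltr0n finField_card_gt0.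
  (* Only extensions of even degree are controlled, so the growth criterion is applied to the
     squares of the inverse roots. *)
  have grow r : (2 * D <= r)%N ->
      `|\sum_(z <- map (fun w => w ^+ 2) ws) z ^+ r| <= (Q.-1 * (3 * D + 1) + D)%:R * Q%:R ^+ r.
    move=> Dr; rewrite big_map (eq_bigr (fun w => w ^+ (r + r))) => [|w' _]; last first.
      by rewrite -exprM mul2n addnn.
    have r0 : (0 < r)%N by apply: leq_trans Dr; rewrite muln_gt0 degree_gt0.
    by rewrite -normrN -SE ?addn_gt0 ?r0 // -natrX; apply: frob_charsum_even.
  have := power_sum_growth archi Q0 grow (map_f (fun w => w ^+ 2) wws).
  rewrite normrX -[X in X <= sqrtC _](sqrCK (normr_ge0 w)) ler_sqrtC //.
  - by rewrite qualifE /= exprn_ge0.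
  - by rewrite qualifE /= ltW.
have S1 : S 1%N = \sum_u \prod_i chi (c i - u) ^+ e i.
  have perm1 : perm_eq (fixed_seq F K 1) [seq iota u | u <- index_enum F].
    apply: uniq_perm; first exact: (fixed_seq_uniq iota).
      by rewrite map_inj_uniq ?index_enum_uniq //; exact: fmorph_inj.
    move=> x; rewrite mem_fixed_seq // expn1; apply/eqP/mapP => [/frob_fixed_iota|].
      by move=> /(_ iota)[u ->]; exists u; rewrite ?mem_index_enum.
    by move=> [u _ ->]; rewrite -[#|F|]expn1 (frob_iota iota).
  rewrite /S /frob_charsum (perm_big _ perm1) big_map; apply: eq_bigr => u _.
  have -> : orbit_polyF iota (iota u) 1 = 'X - u%:P.
    apply: (map_poly_inj iota); rewrite map_orbit_polyF ?(frob_iota iota) //.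
    by rewrite /orbit_poly big_ord1 expn0 expr1 map_polyXsubC.
  by apply: eq_bigr => i _; rewrite !hornerE.
rewrite -S1 SE // normrN (le_trans (ler_norm_sum _ _ _)) //.
apply: le_trans (_ : (size ws)%:R * sqrtC Q%:R <= _); last first.
  rewrite ler_wpM2r ?sqrtC_ge0 ?ler0n // ler_nat.
  by rewrite -ltnS (leq_trans szws) // leqW // size_poly.
apply: le_trans (_ : \sum_(w <- ws) sqrtC Q%:R <= _).
  by rewrite !big_seq; apply: ler_sum.
by rewrite big_const_seq count_predT iter_addr_0 mulr_natl.
Qed.

End WeilBound.

(** * Moments of character sums *)

(** Every value is taken at least twice, so there are at most [l] values, and the tuple factors as a
    map [J -> 'I_l] followed by a map from ['I_l] to [A]. *)
Lemma card_no_unique_value (J T : finType) (A : {pred T}) (l : nat) :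
  (0 < l)%N -> #|J| = (2 * l)%N ->
  (#|[set k : {ffun J -> T} in ffun_on A |
      [forall j0, exists j, (j != j0) && (k j == k j0)]]| <=
   l ^ (2 * l) * #|A| ^ l)%N.
Proof.
move=> l0 cJ.
pose comp (x : {ffun J -> 'I_l} * {ffun 'I_l -> T}) : {ffun J -> T} :=
  [ffun j => x.2 (x.1 j)].
pose B := [predX (predT : pred {ffun J -> 'I_l}) & (ffun_on A : pred {ffun 'I_l -> T})].
have cB : #|B| = (l ^ (2 * l) * #|A| ^ l)%N.
  by rewrite cardX card_ffun_on card_ord card_ffun card_ord cJ.
rewrite -cB; apply: leq_trans (leq_imset_card comp B).
apply/subset_leq_card/fintype.subsetP => k; rewrite !inE => /andP[kA /forallP rep].
have [j1 _] : exists j : J, j \in J by apply/card_gt0P; rewrite cJ muln_gt0.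
pose im := [set k j | j in J].
have im_le : (#|im| <= l)%N.
  rewrite -(leq_pmul2l (_ : 0 < 2)%N) // -cJ -[leqRHS]sum1_card.
  rewrite (partition_big (fun j => k j) (mem im)) /=; last first.
    by move=> j _; apply: imset_f.
  rewrite mulnC -sum_nat_const; apply: leq_sum => y /imsetP[j0 _ ->].
  case/existsP: (rep j0) => j /andP[jj0 /eqP kj].
  by rewrite (bigD1 j0) //= (bigD1 j) //= kj eqxx jj0.
have idx j : (index (k j) (enum im) < l)%N.
  apply: leq_trans im_le; rewrite cardE index_mem mem_enum; exact: imset_f.
(* The default [k j1] keeps [s] inside [A] when fewer than [l] values occur. *)
pose s : {ffun 'I_l -> T} := [ffun i => nth (k j1) (enum im) (i : 'I_l)].
apply/imsetP; exists ([ffun j => Ordinal (idx j)], s).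
  rewrite !inE /=; apply/forallP => i; rewrite ffunE.
  have [lt|ge] := ltnP i (size (enum im)); last first.
    by rewrite nth_default //; move/forallP: kA.
  have := mem_nth (k j1) lt; rewrite mem_enum => /imsetP[j _ ->].
  by move/forallP: kA.
apply/ffunP => j; rewrite !ffunE /= nth_index // mem_enum; exact: imset_f.
Qed.

Section CharacterMoments.
Variables (F : finFieldType) (C : numClosedFieldType) (chi : F -> C).
Hypothesis archi : forall x : C, 0 <= x -> exists n : nat, x < n%:R.
Hypotheses (chi0 : chi 0 = 0) (chi1 : chi 1 = 1).
Hypothesis chiM : forall x y, chi (x * y) = chi x * chi y.
Hypothesis chi_nontriv : exists2 u, u != 0 & chi u != 1.
Local Notation Q := #|F|.

(* Sending the simple node [- k j0] to infinity by [v = 1 / u - k j0] makes the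
   degree of the remaining polynomial prime to [Q - 1]. *)
Lemma shifted_product_bound (J : finType) (k : J -> F) (eps : J -> nat) (j0 : J) :
  (forall j, j != j0 -> k j != k j0) ->
  (Q.-1 %| \sum_j eps j)%N -> coprime (eps j0) Q.-1 ->
  `|\sum_v \prod_j chi (v + k j) ^+ eps j| <= #|J|%:R * sqrtC Q%:R + 1.
Proof.
move=> k_uniq dvdS cop0.
have Q2 := finField_card_gt2 chi1 chi_nontriv.
have eps0 : (0 < eps j0)%N.
  by rewrite lt0n; apply/eqP => e0; move: cop0; rewrite e0 /coprime gcd0n => /eqP; lia.
pose del j := k j - k j0.
have del0 j : j != j0 -> del j != 0 by move=> /k_uniq; rewrite subr_eq0.
pose c j := - (del j)^-1.
pose e j := if j == j0 then 0%N else eps j.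
have eS : (\sum_j eps j = eps j0 + \sum_j e j)%N.
  rewrite (bigD1 j0) //= [in RHS](bigD1 j0) //= /e eqxx add0n; congr (_ + _)%N.
  by apply: eq_bigr => j /negbTE ->.
have copE : coprime (\sum_j e j) Q.-1.
  rewrite /coprime -dvdn1; apply: dvdn_trans (_ : gcdn (eps j0) Q.-1 %| 1)%N; last first.
    by rewrite dvdn1.
  rewrite dvdn_gcd dvdn_gcdr andbT.
  have := dvdn_trans (dvdn_gcdr (\sum_j e j) Q.-1) dvdS.
  by rewrite eS dvdn_addl // dvdn_gcdl.
have W := weil_bound archi chi0 chi1 chiM chi_nontriv c copE.
pose a := \prod_(j | j != j0) chi (- del j) ^+ eps j.
have na : `|a| = 1.
  rewrite normr_prod big1 // => j jj0.
  by rewrite normrX (norm_chi chi1 chiM chi_nontriv) ?expr1n // oppr_eq0 del0.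
have termE u : u != 0 ->
    \prod_j chi (u^-1 - k j0 + k j) ^+ eps j = a * \prod_j chi (c j - u) ^+ e j.
  move=> u0; have -> : \prod_j chi (u^-1 - k j0 + k j) ^+ eps j =
      \prod_j (chi u^-1 ^+ eps j *
        (if j == j0 then 1 else chi (- del j) ^+ eps j * chi (c j - u) ^+ eps j)).
    apply: eq_bigr => j _; case: eqVneq => [->|jj0]; first by rewrite subrK mulr1.
    rewrite -!exprMn -!chiM; congr (chi _ ^+ _).
    have := del0 j jj0; rewrite /c /del => d0; field.
    by rewrite u0 subr_eq0 k_uniq.
  rewrite big_split /= prodrXr.
  have -> : chi u^-1 ^+ (\sum_j eps j) = 1.
    case/dvdnP: dvdS => m ->; rewrite mulnC exprM -(chiX chi1 chiM).
    by rewrite expf_card_pred ?invr_eq0 // chi1 expr1n.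
  rewrite mul1r (bigD1 j0) //= eqxx mul1r [X in _ = a * X](bigD1 j0) //=.
  rewrite {1}/e eqxx expr0 mul1r -big_split /=; apply: eq_bigr => j /negbTE jj0.
  by rewrite jj0 /e jj0.
(* The point [v = - k j0] contributes [0]. The substitution misses [u = 0], which corresponds to
   infinity; restoring it to complete the sum costs the [+ 1]. *)
have -> : \sum_v \prod_j chi (v + k j) ^+ eps j =
    a * (\sum_u \prod_j chi (c j - u) ^+ e j - \prod_j chi (c j) ^+ e j).
  rewrite (bigD1 (- k j0)) //= (bigD1 j0) //= addNr chi0 expr0n eqn0Ngt eps0 mul0r add0r.
  rewrite (reindex_onto (fun u => u^-1 - k j0) (fun v => (v + k j0)^-1)) => [|v _]; last first.
    by rewrite invrK addrK.
  rewrite (eq_bigl (fun u => u != 0)) => [|u]; last first.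
    by rewrite subrK invrK eqxx andbT -subr_eq0 opprK subrK invr_eq0.
  rewrite [X in _ = a * (X - _)](bigD1 0) //=.
  under [X in X + _ - _]eq_bigr => j _ do rewrite subr0.
  by rewrite addrAC subrr add0r mulr_sumr; apply: eq_bigr => u; exact: termE.
rewrite normrM na mul1r (le_trans (ler_normB _ _)) // lerD //.
rewrite normr_prod -[leRHS](big1_eq (op := GRing.mul) (index_enum J) xpredT).
apply: ler_prod => j _; rewrite normr_ge0 /= normrX /e.
case: eqVneq => [_|jj0]; first by rewrite expr0.
by rewrite (norm_chi chi1 chiM chi_nontriv) ?expr1n // oppr_eq0 invr_eq0 del0.
Qed.

Lemma norm_chi_le1 x : `|chi x| <= 1.
Proof.
have [->|x0] := eqVneq x 0; first by rewrite chi0 normr0 ler01.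
by rewrite (norm_chi chi1 chiM chi_nontriv).
Qed.

(** A power rather than an inverse keeps conjugates within the products covered by Weil's bound,
    also at [x = 0] since [Q - 2 > 0]. *)
Lemma conj_chi x : (chi x)^* = chi x ^+ Q.-2.
Proof.
have Q2 := finField_card_gt2 chi1 chi_nontriv.
have [->|x0] := eqVneq x 0.
  have Q20 : (Q.-2 == 0)%N = false by apply/eqP; lia.
  by rewrite chi0 conjC0 expr0n Q20.
have nx := norm_chi chi1 chiM chi_nontriv x0.
have cx0 : chi x != 0 by rewrite -normr_eq0 nx oner_eq0.
apply: (mulfI cx0); rewrite -normCK nx expr1n -exprS.
have -> : Q.-2.+1 = Q.-1 by lia.
by rewrite -(chiX chi1 chiM) expf_card_pred.
Qed.

(** [J] indexes [l] factors and [l] conjugate factors, of exponents [1] and [Q - 2]. Their total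
    [l * (Q - 1)] is divisible by [Q - 1] while each is prime to it, as [shifted_product_bound]
    requires. Tuples without a simple value get the trivial bound [Q]. *)
Lemma moment_bound (A : {set F}) (zeta : F -> C) (l : nat) : (0 < l)%N ->
  (forall k, k \in A -> `|zeta k| <= 1) ->
  \sum_v `|\sum_(k in A) zeta k * chi (v + k)| ^+ (2 * l) <=
  (l ^ (2 * l))%:R * #|A|%:R ^+ l * Q%:R +
  #|A|%:R ^+ (2 * l) * ((2 * l)%:R * sqrtC Q%:R + 1).
Proof.
move=> l0 zeta1.
have Q2 := finField_card_gt2 chi1 chi_nontriv.
pose J : finType := (bool * 'I_l)%type.
have cJ : #|J| = (2 * l)%N by rewrite card_prod card_bool card_ord.
pose eps (j : J) := if j.1 then 1%N else Q.-2.
pose w (j : J) k := if j.1 then zeta k else (zeta k)^*.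
have w1 j k : k \in A -> `|w j k| <= 1.
  by move=> kA; rewrite /w; case: ifP; rewrite ?norm_conjC zeta1.
have powE v : `|\sum_(k in A) zeta k * chi (v + k)| ^+ (2 * l) =
    \sum_(f : {ffun J -> F} | f \in ffun_on (mem A))
      (\prod_j w j (f j)) * \prod_j chi (v + f j) ^+ eps j.
  set z := \sum_(k in A) _.
  transitivity (\prod_(j : J) (if j.1 then z else z^*)).
    rewrite -(pair_bigA _ (fun (b : bool) (i : 'I_l) => if b then z else z^*)) /=.
    rewrite big_bool /= !prodr_const card_ord -exprMn -normCK -exprM //.
  transitivity (\prod_(j : J) \sum_(k in A) w j k * chi (v + k) ^+ eps j).
    apply: eq_bigr => j _; rewrite /w /eps; case: (j.1) => //.
    by rewrite /z rmorph_sum /=; apply: eq_bigr => k _; rewrite rmorphM /= conj_chi.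
  rewrite bigA_distr_big; apply: eq_bigr => f _; exact: big_split.
have LHS0 : 0 <= \sum_v `|\sum_(k in A) zeta k * chi (v + k)| ^+ (2 * l).
  by apply: sumr_ge0 => v _; rewrite exprn_ge0.
rewrite -(ger0_norm LHS0) {LHS0}.
under eq_bigr => v _ do rewrite powE.
rewrite exchange_big /=.
under eq_bigr => f _ do rewrite -mulr_sumr.
pose T (f : {ffun J -> F}) := \sum_v \prod_j chi (v + f j) ^+ eps j.
have T_le f : `|T f| <= Q%:R.
  apply: (le_trans (ler_norm_sum _ _ _)).
  apply: le_trans (_ : \sum_(v : F) 1 <= _); last by rewrite sumr_const.
  apply: ler_sum => v _; rewrite normr_prod prodr_ile1 // => j _.
  by rewrite normr_ge0 normrX exprn_ile1 ?norm_chi_le1.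
pose bad (f : {ffun J -> F}) := [forall j0, exists j, (j != j0) && (f j == f j0)].
have T_good f : ~~ bad f -> `|T f| <= (2 * l)%:R * sqrtC Q%:R + 1.
  rewrite negb_forall => /existsP[j0]; rewrite negb_exists => /forallP h.
  rewrite -cJ; apply: (shifted_product_bound (j0 := j0)).
  - by move=> j jj0; have := h j; rewrite jj0.
  - rewrite -(pair_bigA _ (fun (b : bool) (i : 'I_l) => if b then 1%N else Q.-2)) /=.
    rewrite big_bool /= !sum_nat_const card_ord -mulnDr dvdn_mull //.
    by have -> : (1 + Q.-2 = Q.-1)%N by lia.
  rewrite /eps; case: (j0.1); first by rewrite coprime1n.
  have -> : Q.-1 = Q.-2.+1 by lia.
  exact: coprimenS.
apply: le_trans (_ : \sum_(f : {ffun J -> F} | f \in ffun_on (mem A)) `|T f| <= _).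
  apply: (le_trans (ler_norm_sum _ _ _)); apply: ler_sum => f /forallP fA.
  rewrite normrM -[leRHS]mul1r ler_wpM2r // normr_prod prodr_ile1 // => j _.
  by rewrite normr_ge0 w1.
rewrite (bigID bad) /= lerD //.
  apply: le_trans (_ : \sum_(f : {ffun J -> F} | (f \in ffun_on (mem A)) && bad f) Q%:R <= _).
    by apply: ler_sum.
  rewrite sumr_const -[leLHS]mulr_natl ler_wpM2r // -natrX -natrM ler_nat.
  have := card_no_unique_value (mem A) l0 cJ; rewrite cardsE.
  move=> le; apply: leq_trans le; apply: eq_leq; exact: eq_card.
apply: le_trans (_ : \sum_(f : {ffun J -> F} | (f \in ffun_on (mem A)) && ~~ bad f)
  ((2 * l)%:R * sqrtC Q%:R + 1) <= _).
  by apply: ler_sum => f /andP[_ fb]; exact: T_good.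
rewrite sumr_const -[leLHS]mulr_natl ler_wpM2r //.
rewrite -natrX ler_nat -cJ -card_ffun_on.
by apply: subset_leq_card; apply/fintype.subsetP => f /andP[].
Qed.

End CharacterMoments.

(** * The divisor bound *)

Lemma size_divisors n :
  size (divisors n) = (\prod_(p <- primes n) (logn p n).+1)%N.
Proof.
rewrite /divisors prime_decompE; elim: (primes n) => [|p ps IH] /=.
  by rewrite big_nil.
rewrite big_cons -IH /=; elim: (logn p n) => [|e IHe] /=; first by rewrite mul1n.
by rewrite size_merge size_cat size_map IHe -mulSnr.
Qed.

Lemma expn_succ_le k a : (0 < k)%N -> (a.+1 ^ k <= k ^ k * 2 ^ a)%N.
Proof.
move=> k0; have le1 : (a.+1 <= k * 2 ^ (a %/ k))%N.
  apply: leq_trans (_ : k * (a %/ k).+1 <= _)%N; last by rewrite leq_mul2l ltn_expl ?orbT.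
  by rewrite mulnC ltn_ceil.
apply: (@leq_trans ((k * 2 ^ (a %/ k)) ^ k)); first by rewrite leq_exp2r.
by rewrite expnMn leq_mul2l -expnM leq_exp2l // leq_trunc_div orbT.
Qed.

(** Prime by prime: for [q >= 2 ^ k] one has [(e + 1) ^ k <= 2 ^ (e k) <= q ^ e], and each of the
    fewer than [2 ^ k] smaller primes costs an extra factor [k ^ k]. *)
Lemma size_divisors_bound k n : (0 < k)%N -> (0 < n)%N ->
  (size (divisors n) ^ k <= (k ^ k) ^ (2 ^ k) * n)%N.
Proof.
move=> k0 n0; rewrite size_divisors.
have nE : n = (\prod_(q <- primes n) q ^ logn q n)%N.
  by rewrite {1}(prod_prime_decomp n0) prime_decompE big_map.
rewrite [X in (_ <= _ * X)%N]nE.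
have exp_prod (s : seq nat) (h : nat -> nat) :
    ((\prod_(q <- s) h q) ^ k = \prod_(q <- s) h q ^ k)%N.
  by apply: (big_morph (expn^~ k)) => [x y|]; rewrite ?expnMn ?exp1n.
rewrite exp_prod.
apply: (@leq_trans (\prod_(q <- primes n) ((if (q < 2 ^ k)%N then k ^ k else 1) * q ^ logn q n))%N).
  rewrite big_seq [leqRHS]big_seq; apply: leq_prod => q.
  rewrite mem_primes => /and3P[q_pr _ _]; case: ltnP => q2.
    apply: leq_trans (expn_succ_le _ k0) _.
    rewrite leq_mul2l; apply/orP; right.
    by case: (logn q n) => // e; rewrite leq_exp2r // prime_gt1.
  rewrite mul1n; apply: (@leq_trans ((2 ^ logn q n) ^ k)).
    by rewrite leq_exp2r // ltn_expl.
  rewrite -expnM mulnC expnM.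
  by case: (logn q n) => // e; rewrite leq_exp2r.
rewrite big_split leq_mul2r; apply/orP; right.
rewrite -big_mkcond /= big_const_seq iter_muln_1.
rewrite leq_pexp2l ?expn_gt0 ?k0 // -size_filter.
rewrite -[leqRHS](size_iota 0); apply: uniq_leq_size; first by rewrite filter_uniq ?primes_uniq.
by move=> q; rewrite mem_filter mem_iota => /andP[].
Qed.

Lemma card_factorizations S u : (0 < u)%N ->
  (#|[pred z : 'I_S * 'I_S | (z.1.+1 * z.2.+1 == u)%N]| <= size (divisors u))%N.
Proof.
move=> u0; set A := [pred z | _].
have inj : {in A &, injective (fun z : 'I_S * 'I_S => z.1.+1)}.
  move=> [x y] [x' y']; rewrite !inE /= => /eqP E1 /eqP E2 [xx].
  move: E2; rewrite -E1 xx => /eqP; rewrite eqn_pmul2l // eqSS => /eqP yy.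
  by congr (_, _); apply: val_inj.
rewrite -(size_image (fun z : 'I_S * 'I_S => z.1.+1) A); apply: uniq_leq_size.
  by rewrite map_inj_in_uniq ?enum_uniq // => z z'; rewrite !mem_enum; exact: inj.
move=> d /fintype.imageP[z]; rewrite inE => /eqP zu ->; rewrite -dvdn_divisors //.
by rewrite -zu dvdn_mulr.
Qed.

(** * Counting lattice points in a box *)

Lemma eq_of_coprime_div a b y y' k k' : (0 < b)%N -> coprime a b ->
  (y * a + k * b = y' * a + k' * b)%N -> (y %/ b = y' %/ b)%N -> y = y'.
Proof.
move=> b0 cop; wlog le : y y' k k' / (y' <= y)%N => [hw|] E q.
  case/orP: (leq_total y y') => le; last exact: (hw y y' k k').
  by apply/esym; apply: (hw y' y k' k).
have dv : (b %| y - y')%N.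
  rewrite -(@Gauss_dvdl _ _ a) 1?coprime_sym //.
  by apply/dvdnP; exists (k' - k)%N; rewrite !mulnBl; lia.
have lt : (y - y' < b)%N.
  rewrite {1}(divn_eq y b) {1}(divn_eq y' b) q subnDl.
  exact: leq_ltn_trans (leq_subr _ _) (ltn_pmod _ b0).
have [e|e] := posnP (y - y'); first by apply/eqP; rewrite eqn_leq le -subn_eq0 e.
by have := dvdn_leq e dv; rewrite leqNgt lt.
Qed.

(* [max a b = b] here: on each line [x b -+ y a = p j] the points differ by
   multiples of [(a, b)], so [y %/ b] determines the point. *)
Lemma lattice_count (p a b H : nat) :
  (0 < p)%N -> (0 < b)%N -> coprime a b -> (a <= b)%N ->
  (#|[pred z : 'I_H * 'I_H | (p %| z.1.+1 * b + z.2.+1 * a)%N ||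
        (p %| z.1.+1 * b + p * ((H * a) %/ p).+1 - z.2.+1 * a)%N]| <=
   2 * ((2 * (H * b)) %/ p + 3) * (H %/ b + 1))%N.
Proof.
move=> p0 b0 cop ab; set L := ((H * a) %/ p).+1.
set n1 := ((2 * (H * b)) %/ p + 2)%N; set n2 := (H %/ b)%N.
have -> : (2 * ((2 * (H * b)) %/ p + 3) * (H %/ b + 1) =
           #|{: bool * 'I_n1.+1 * 'I_n2.+1}|)%N.
  by rewrite !card_prod card_bool !card_ord /n1 /n2 !addn1 addn2 addn3.
pose V (z : 'I_H * 'I_H) (s : bool) :=
  (if s then z.1.+1 * b + z.2.+1 * a else z.1.+1 * b + p * L - z.2.+1 * a)%N.
pose sg (z : 'I_H * 'I_H) := (p %| V z true)%N.
pose f (z : 'I_H * 'I_H) : bool * 'I_n1.+1 * 'I_n2.+1 :=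
  (sg z, inord (V z (sg z) %/ p), inord (z.2.+1 %/ b)).
(* The shift by [p * L] makes the truncated subtraction exact and does not matter modulo [p]. *)
have pL : (H * a <= p * L)%N by rewrite [leqRHS]mulnC ltnW // ltn_ceil.
have xb (x : 'I_H) : (x.+1 * b <= H * b)%N by rewrite leq_mul2r ltn_ord orbT.
have ya (y : 'I_H) : (y.+1 * a <= H * a)%N by rewrite leq_mul2r ltn_ord orbT.
have Hab : (H * a <= H * b)%N by rewrite leq_mul2l ab orbT.
have Vlt z s : (V z s %/ p < n1.+1)%N.
  rewrite ltnS /n1; have := xb z.1; have := ya z.2; rewrite /V; case: s => hy hx.
    by apply: leq_trans (leq_addr _ _); apply: leq_div2r; lia.
  apply: (@leq_trans ((H * b + p * L) %/ p)).
    by apply: leq_div2r; lia.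
  have : ((H * b) %/ p + (H * a) %/ p <= (2 * (H * b)) %/ p)%N.
    rewrite leq_divRL // mulnDl mul2n -addnn.
    by apply: leq_add; [exact: leq_trunc_div | apply: leq_trans Hab; exact: leq_trunc_div].
  by rewrite [(_ + p * L)%N]addnC [(p * L)%N]mulnC divnMDl // /L; lia.
have tlt (z : 'I_H * 'I_H) : (z.2.+1 %/ b < n2.+1)%N.
  by rewrite ltnS leq_div2r.
apply: (leq_card_in f) => -[x y] [x' y'].
rewrite !inE /= => h h' [sE /(congr1 (@nat_of_ord _)) jE /(congr1 (@nat_of_ord _)) tE].
rewrite !inordK ?Vlt ?(tlt (x, y)) ?(tlt (x', y')) //= in jE tE.
have dvdV z : (p %| V z true)%N || (p %| V z false)%N -> (p %| V z (sg z))%N.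
  by rewrite /sg; case: (boolP (p %| V z true)%N).
have VE : V (x, y) (sg (x, y)) = V (x', y') (sg (x', y')).
  by rewrite -[LHS](divnK (dvdV (x, y) h)) -[RHS](divnK (dvdV (x', y') h')) jE.
move: VE; rewrite -sE; have := ya y; have := ya y'; rewrite /V /=; case: (sg (x, y)) => hy' hy VE.
  have yy : y.+1 = y'.+1.
    by apply: (eq_of_coprime_div (k := x.+1) (k' := x'.+1) b0 cop _ tE); rewrite addnC VE addnC.
  move: VE; rewrite yy => /eqP; rewrite eqn_add2r eqn_pmul2r // => /eqP xx.
  by case: xx => xx; case: yy => yy; congr (_, _); apply: val_inj.
have VE' : (y.+1 * a + x'.+1 * b = y'.+1 * a + x.+1 * b)%N.
  move: VE hy hy' pL.
  move: (x.+1 * b)%N (x'.+1 * b)%N (y.+1 * a)%N (y'.+1 * a)%N (p * L)%N (H * a)%N.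
  by clear; lia.
have yy := eq_of_coprime_div b0 cop VE' tE.
have : (x.+1 * b == x'.+1 * b)%N by move/eqP: VE'; rewrite yy eqn_add2l eq_sym.
rewrite eqn_pmul2r // => /eqP [xx]; case: yy => yy.
by congr (_, _); apply: val_inj.
Qed.

(** * The energy *)

Section Energy.
Variables (p : nat) (p_pr : prime p).
Implicit Types (m : 'F_p) (M : {set 'F_p}).

(* The squares allow both signs in [x m2 = +- y m1], so that lattice vectors can be
   taken with natural coordinates. *)
Definition Jcount m1 m2 H : nat :=
  #|[pred z : 'I_H * 'I_H | (z.1.+1%:R * m2) ^+ 2 == (z.2.+1%:R * m1) ^+ 2]|.

Lemma natr_Fp_eq0 n : (n%:R == 0 :> 'F_p) = (p %| n)%N.
Proof. by rewrite -(dvdn_pcharf (pchar_Fp p_pr)). Qed.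

Lemma Fp_dist (u v : nat) : (`|u%:Z - v%:Z|%N%:R) ^+ 2 = (u%:R - v%:R) ^+ 2 :> 'F_p.
Proof.
wlog uv : u v / (u <= v)%N => [hw|].
  case/orP: (leq_total u v) => uv; first exact: hw.
  by rewrite distnC hw // -sqrrN opprB.
by rewrite distnEr // natrB // -sqrrN opprB.
Qed.

(** Thue's pigeonhole argument: with [k] the integer part of the square root of [p], more than [p]
    pairs are mapped to ['F_p], and two of them collide. Dividing by the gcd makes the short vector
    primitive. *)
Lemma thue m1 m2 : m1 != 0 -> m2 != 0 ->
  exists a b : nat, [/\ (0 < a)%N, (0 < b)%N, (a * a <= p)%N, (b * b <= p)%N &
    coprime a b /\ (a%:R * m2) ^+ 2 = (b%:R * m1) ^+ 2].
Proof.
move=> m10 m20.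
have p1 := prime_gt1 p_pr.
have exk : exists k, (k * k <= p)%N by exists 0%N.
have bk k : (k * k <= p)%N -> (k <= p)%N by nia.
case: (ex_maxnP exk bk) => k kk kmax.
have k1 : (p < k.+1 * k.+1)%N by rewrite ltnNge; apply/negP => /kmax; rewrite ltnn.
have kp : (k < p)%N by nia.
pose f (z : 'I_k.+1 * 'I_k.+1) : 'F_p := (z.1 : nat)%:R * m2 - (z.2 : nat)%:R * m1.
have : ~~ injectiveb f.
  apply/negP => /injectiveP /leq_card; rewrite card_prod card_ord card_Fp //.
  by rewrite leqNgt k1.
case/injectivePn => -[u v] [[u' v'] neq]; rewrite /f /= => /eqP.
rewrite subr_eq addrAC eq_sym subr_eq => /eqP E.
pose a0 := `|u%:Z - u'%:Z|%N; pose b0 := `|v%:Z - v'%:Z|%N.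
have E0 : (a0%:R * m2) ^+ 2 = (b0%:R * m1) ^+ 2.
  rewrite !exprMn !Fp_dist -!exprMn; congr (_ ^+ 2).
  rewrite !mulrBl; apply/eqP; rewrite subr_eq addrAC eq_sym subr_eq; apply/eqP.
  by rewrite -E addrC.
have a0k : (a0 <= k)%N by have := ltn_ord u; have := ltn_ord u'; rewrite /a0; lia.
have b0k : (b0 <= k)%N by have := ltn_ord v; have := ltn_ord v'; rewrite /b0; lia.
have lt_neq0 n : (0 < n)%N -> (n <= k)%N -> n%:R != 0 :> 'F_p.
  move=> n0 nk; rewrite natr_Fp_eq0; apply/negP => /(dvdn_leq n0); lia.
have zab : (a0 == 0%N) = (b0 == 0%N).
  apply/eqP/eqP => z; move: E0; rewrite z mul0r expr0n /=.
    move/esym/eqP; rewrite expf_eq0 mulf_eq0 (negbTE m10) orbF /=.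
    by have [//|b0'] := posnP b0; rewrite (negbTE (lt_neq0 _ b0' _)).
  move/eqP; rewrite expf_eq0 mulf_eq0 (negbTE m20) orbF /=.
  by have [//|a0'] := posnP a0; rewrite (negbTE (lt_neq0 _ a0' _)).
have a00 : (0 < a0)%N.
  rewrite lt0n; apply/negP => z; have zb : b0 == 0%N by rewrite -zab.
  move: neq; apply/negP; rewrite negbK; apply/eqP; congr (_, _); apply: val_inj => /=.
    by move: z; rewrite /a0; lia.
  by move: zb; rewrite /b0; lia.
have b00 : (0 < b0)%N by rewrite lt0n -zab -lt0n.
pose g := gcdn a0 b0.
have g0 : (0 < g)%N by rewrite gcdn_gt0 a00.
have aE : a0 = (a0 %/ g * g)%N by rewrite divnK // dvdn_gcdl.
have bE : b0 = (b0 %/ g * g)%N by rewrite divnK // dvdn_gcdr.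
exists (a0 %/ g)%N, (b0 %/ g)%N; split.
- by rewrite divn_gt0 // dvdn_leq // dvdn_gcdl.
- by rewrite divn_gt0 // dvdn_leq // dvdn_gcdr.
- by apply: leq_trans kk; apply: leq_mul; apply: leq_trans (leq_div _ _) _.
- by apply: leq_trans kk; apply: leq_mul; apply: leq_trans (leq_div _ _) _.
split; first by rewrite /coprime -(eqn_pmul2r g0) muln_gcdl -aE -bE mul1n.
have gn0 : g%:R ^+ 2 != 0 :> 'F_p.
  by rewrite expf_neq0 // lt_neq0 // (leq_trans _ a0k) // dvdn_leq // dvdn_gcdl.
apply: (mulIf gn0); rewrite -!exprMn mulrAC -natrM -aE mulrAC -natrM -bE.
exact: E0.
Qed.

Lemma Jcount_sym m1 m2 H : Jcount m1 m2 H = Jcount m2 m1 H.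
Proof.
rewrite /Jcount -!sum1_card.
rewrite (reindex_inj (h := fun z : 'I_H * 'I_H => (z.2, z.1))) /=.
  by apply: eq_bigl => z; rewrite !inE eq_sym.
by move=> [x y] [x' y'] [-> ->].
Qed.

Lemma Jcount_upper m1 m2 a b H : m1 != 0 -> m2 != 0 ->
  (0 < b)%N -> coprime a b -> (a <= b)%N ->
  (a%:R * m2) ^+ 2 = (b%:R * m1) ^+ 2 ->
  (Jcount m1 m2 H <= 2 * ((2 * (H * b)) %/ p + 3) * (H %/ b + 1))%N.
Proof.
move=> m10 m20 b0 cop ab E; have p0 := prime_gt0 p_pr.
apply: leq_trans (lattice_count H p0 b0 cop ab).
apply: subset_leq_card; apply/fintype.subsetP => -[x y]; rewrite !inE /= => /eqP xy.
have : (x.+1%:R * b%:R) ^+ 2 == (y.+1%:R * a%:R) ^+ 2 :> 'F_p.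
  have n0 : (m1 * m2) ^+ 2 != 0 by rewrite expf_neq0 // mulf_neq0.
  apply/eqP; apply: (mulIf n0).
  transitivity ((x.+1%:R * m2) ^+ 2 * (b%:R * m1) ^+ 2); first by ring.
  by rewrite xy -E; ring.
rewrite -subr_eq0 subr_sqr mulf_eq0 orbC => /orP[|] h; apply/orP; [left|right].
  by rewrite -natr_Fp_eq0 natrD !natrM.
have le : (y.+1 * a <= x.+1 * b + p * ((H * a) %/ p).+1)%N.
  apply: leq_trans (leq_addl _ _); rewrite mulnC [leqRHS]mulnC.
  by apply: leq_trans (ltnW (ltn_ceil _ p0)); rewrite mulnC leq_mul2r ltn_ord orbT.
by rewrite -natr_Fp_eq0 natrB // natrD !natrM pchar_Fp_0 // mul0r addr0.
Qed.

Lemma Jcount_lower m1 m2 a b S : (0 < a)%N -> (0 < b)%N -> (a <= b)%N ->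
  (a%:R * m2) ^+ 2 = (b%:R * m1) ^+ 2 -> (S %/ b <= Jcount m1 m2 S)%N.
Proof.
move=> a0 b0 ab E.
have lt (t : 'I_(S %/ b)) c : (0 < c)%N -> (c <= b)%N -> ((t.+1 * c).-1 < S)%N.
  move=> c0 cb; rewrite prednK ?muln_gt0 //.
  apply: leq_trans (leq_trunc_div S b); exact: leq_mul.
pose h t : 'I_S * 'I_S := (Ordinal (lt t a a0 ab), Ordinal (lt t b b0 (leqnn b))).
have h_inj : injective h.
  move=> t t' [_ /(congr1 succn)]; rewrite !prednK ?muln_gt0 ?b0 // => /eqP.
  by rewrite eqn_pmul2r // eqSS => /eqP /val_inj.
rewrite -[leqLHS]card_ord -(fintype.card_image h_inj).
apply: subset_leq_card; apply/fintype.subsetP => z /fintype.imageP[t _ ->].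
rewrite !inE /= !prednK ?muln_gt0 ?a0 ?b0 // !natrM -!mulrA.
by rewrite [_ ^+ 2]exprMn [X in _ == X]exprMn E.
Qed.

(** The size [b] of the short vector is unknown and has to be eliminated. Its multiples are
    themselves counted at scale [S], so [S / b <= Jcount m1 m2 S + 1], which controls the term
    [H / b] of the upper bound at scale [H]. *)
Lemma Jcount_doubling (R : realFieldType) m1 m2 H S : m1 != 0 -> m2 != 0 -> (0 < S)%N ->
  (Jcount m1 m2 H)%:R <= 8 * (1 + H%:R ^+ 2 / p%:R) +
     8 * (H%:R / S%:R) * ((Jcount m1 m2 S)%:R + 1) :> R.
Proof.
move=> m10 m20 S0; have [a [b [a0 b0 aap bbp [cop E]]]] := thue m10 m20.
wlog ab : m1 m2 a b m10 m20 a0 b0 aap bbp cop E / (a <= b)%N => [hw|].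
  case/orP: (leq_total a b) => ab; first exact: (hw m1 m2 a b).
  rewrite Jcount_sym [Jcount m1 m2 S]Jcount_sym.
  by apply: (hw m2 m1 b a); rewrite // coprime_sym.
have up := Jcount_upper H m10 m20 b0 cop ab E.
have low := Jcount_lower S a0 b0 ab E.
have p0 : 0 < p%:R :> R by rewrite ltr0n prime_gt0.
have b0' : 0 < b%:R :> R by rewrite ltr0n.
have S0' : 0 < S%:R :> R by rewrite ltr0n.
have le_div (x y : nat) : (0 < y)%N -> (x %/ y)%:R <= x%:R / y%:R :> R.
  by move=> y0; rewrite ler_pdivlMr ?ltr0n // -natrM ler_nat leq_trunc_div.
have up' : (Jcount m1 m2 H)%:R <= 2 * (2 * (H%:R * b%:R) / p%:R + 3) * (H%:R / b%:R + 1) :> R.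
  apply: (@le_trans _ _ (2 * ((2 * (H * b)) %/ p + 3) * (H %/ b + 1))%:R).
    by rewrite ler_nat.
  rewrite !natrM !natrD.
  have h1 := le_div (2 * (H * b))%N p (prime_gt0 p_pr).
  have h2 := le_div H b b0.
  rewrite !natrM in h1.
  by apply: ler_pM => //; rewrite ?mulr_ge0 ?addr_ge0 // ?ler_wpM2l // lerD.
have Sb : S%:R / b%:R <= (Jcount m1 m2 S)%:R + 1 :> R.
  rewrite ler_pdivrMr // natr1 -natrM ler_nat ltnW //.
  by apply: leq_trans (ltn_ceil S b0) _; rewrite leq_mul2r ltnS low orbT.
have Hb : H%:R / b%:R <= H%:R / S%:R * ((Jcount m1 m2 S)%:R + 1) :> R.
  have -> : H%:R / b%:R = H%:R / S%:R * (S%:R / b%:R) :> R by field; rewrite !gt_eqF.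
  by rewrite ler_wpM2l // divr_ge0.
apply: (le_trans up').
set J1 := (Jcount m1 m2 S)%:R + 1 in Hb *.
have -> : 2 * (2 * (H%:R * b%:R) / p%:R + 3) * (H%:R / b%:R + 1) =
   4 * (H%:R ^+ 2 / p%:R) + 4 * (H%:R * b%:R / p%:R) + 6 * (H%:R / b%:R) + 6 :> R.
  by field; rewrite !gt_eqF.
(* The arithmetic-geometric mean inequality with [b ^ 2 <= p]. *)
have hb : H%:R * b%:R / p%:R <= (H%:R ^+ 2 / p%:R + 1) / 2 :> R.
  rewrite ler_pdivrMr // mulrAC mulrDl divfK ?gt_eqF // mul1r ler_pdivlMr //.
  have bb : b%:R * b%:R <= p%:R :> R by rewrite -natrM ler_nat.
  have : 0 <= (H%:R - b%:R) ^+ 2 :> R by apply: sqr_ge0.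
  by nra.
have H0 : 0 <= H%:R ^+ 2 / p%:R :> R by rewrite divr_ge0 ?sqr_ge0.
have HS0 : 0 <= H%:R / S%:R * J1 by apply: le_trans Hb; rewrite divr_ge0.
by lra.
Qed.

Definition energy M H : nat := \sum_(m1 in M) \sum_(m2 in M) Jcount m1 m2 H.

Lemma energy_doubling (R : realFieldType) M H S : 0 \notin M -> (0 < S)%N ->
  (energy M H)%:R <= 8 * (1 + H%:R ^+ 2 / p%:R) * #|M|%:R ^+ 2 +
     8 * (H%:R / S%:R) * ((energy M S)%:R + #|M|%:R ^+ 2) :> R.
Proof.
move=> M0 S0; rewrite !natr_sum.
have nz m : m \in M -> m != 0 by move=> mM; apply: contraNneq M0 => <-.
apply: le_trans (_ : \sum_(m1 in M) \sum_(m2 in M) (8 * (1 + H%:R ^+ 2 / p%:R) +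
     8 * (H%:R / S%:R) * ((Jcount m1 m2 S)%:R + 1)) <= _).
  apply: ler_sum => m1 m1M; rewrite natr_sum; apply: ler_sum => m2 m2M.
  by apply: Jcount_doubling; rewrite ?nz.
set c := 8 * (1 + _); set d := 8 * (_ / _).
have sc (x : R) : \sum_(m in M) x = x * #|M|%:R by rewrite sumr_const mulr_natr.
rewrite (eq_bigr (fun m1 => c * #|M|%:R + d * ((\sum_(m2 in M) Jcount m1 m2 S)%:R + #|M|%:R))).
  by rewrite big_split /= sc -mulr_sumr big_split /= sc -mulrA -!expr2.
by move=> m1 _; rewrite big_split /= sc -mulr_sumr big_split /= sc mul1r natr_sum.
Qed.

Lemma card_sqr_roots_le2 (x c : 'F_p) : x != 0 ->
  (#|[pred m | (x * m) ^+ 2 == c]| <= 2)%N.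
Proof.
move=> x0; case: (pickP [pred m | (x * m) ^+ 2 == c]) => [m0 /= /eqP m0c|none]; last first.
  by rewrite eq_card0.
apply: (@leq_trans #|pred2 m0 (- m0)|); last by rewrite card2; case: (_ != _).
apply: subset_leq_card; apply/fintype.subsetP => m; rewrite !inE -m0c.
by rewrite !exprMn (inj_eq (mulfI (expf_neq0 2 x0))) eqf_sqr.
Qed.

Lemma sum_fiber_le (T U : finType) (h : T -> U) (w : U -> nat) (n : nat) :
  (forall u, (#|[pred t | h t == u]| <= n)%N) ->
  (\sum_t w (h t) <= n * \sum_u w u)%N.
Proof.
move=> fib; rewrite (partition_big h predT) //= big_distrr /=; apply: leq_sum => u _.
rewrite (eq_bigr (fun=> w u)) => [|t /eqP -> //].
by rewrite sum_nat_const leq_mul2r fib orbT.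
Qed.

(** Eliminating [m1] from [x m = +- y m1] and [x' m' = +- y' m1] gives [(x y') m = +- (x' y) m'].
    Each product has at most [tau] factorizations, and [x], [y], [m] determine [m1] up to sign
    because [y <= S < p] is invertible. *)
Lemma Jcount_product m m' S tau : (S < p)%N ->
  (forall u, (0 < u)%N -> (u <= S * S)%N -> (size (divisors u) <= tau)%N) ->
  (\sum_(m1 : 'F_p) Jcount m1 m S * Jcount m1 m' S <=
   2 * (tau * tau * Jcount m' m (S * S)))%N.
Proof.
move=> Sp tauP.
pose T := (('I_S * 'I_S) * ('I_S * 'I_S))%type.
have neq0 (y : 'I_S) : y.+1%:R != 0 :> 'F_p.
  by rewrite natr_Fp_eq0; apply/negP => /(dvdn_leq (ltn0Sn y)); have := ltn_ord y; lia.
pose P m1 m2 (z : 'I_S * 'I_S) := (z.1.+1%:R * m2) ^+ 2 == (z.2.+1%:R * m1) ^+ 2.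
have lt (x y : 'I_S) : ((x.+1 * y.+1).-1 < S * S)%N.
  by rewrite prednK // leq_mul.
pose h (t : T) : 'I_(S * S) * 'I_(S * S) :=
  (Ordinal (lt t.1.1 t.2.2), Ordinal (lt t.2.1 t.1.2)).
pose w (u : 'I_(S * S) * 'I_(S * S)) : nat :=
  ((u.1.+1%:R * m) ^+ 2 == (u.2.+1%:R * m') ^+ 2 :> 'F_p).
have hE t : ((h t).1.+1 = t.1.1.+1 * t.2.2.+1)%N /\ ((h t).2.+1 = t.2.1.+1 * t.1.2.+1)%N.
  by split; apply: prednK.
have step1 m1 : (Jcount m1 m S * Jcount m1 m' S = \sum_(t : T) P m1 m t.1 * P m1 m' t.2)%N.
  rewrite /Jcount -!sum1_card.
  rewrite [X in (X * _)%N]big_mkcond [X in (_ * X)%N]big_mkcond /= big_distrlr /=.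
  by rewrite pair_big /=; apply: eq_bigr => t _; rewrite !inE /P; do 2 case: (_ == _).
rewrite (eq_bigr _ (fun m1 _ => step1 m1)) exchange_big /=.
apply: (@leq_trans (\sum_(t : T) 2 * w (h t))); last first.
  rewrite -big_distrr /= leq_mul2l /=.
  have -> : Jcount m' m (S * S) = (\sum_u w u)%N.
    rewrite /Jcount -sum1_card big_mkcond /=; apply: eq_bigr => u _.
    by rewrite inE /w; case: (_ == _).
  apply: sum_fiber_le => -[u v].
  pose A n := [pred z : 'I_S * 'I_S | (z.1.+1 * z.2.+1 == n)%N].
  (* Regrouped as [(x, y')] and [(x', y)], a fiber of [h] lies in a product of two sets of
     factorizations. *)
  pose sw (t : T) : T := ((t.1.1, t.2.2), (t.2.1, t.1.2)).
  have sw_inj : injective sw by move=> [[? ?] [? ?]] [[? ?] [? ?]] [-> -> -> ->].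
  rewrite -(fintype.card_image sw_inj).
  apply: (@leq_trans #|[predX A u.+1 & A v.+1]|).
    apply: subset_leq_card; apply/fintype.subsetP => t /fintype.imageP[t']; rewrite inE.
    move=> /eqP E ->; have := congr1 (fun q : 'I_(S * S) * 'I_(S * S) => q.1.+1) E.
    have := congr1 (fun q : 'I_(S * S) * 'I_(S * S) => q.2.+1) E.
    by rewrite (hE t').1 (hE t').2 /= => e2 e1; rewrite !inE /= e1 e2 !eqxx.
  by rewrite cardX leq_mul // (leq_trans (card_factorizations _ _)) // tauP.
apply: leq_sum => t _; rewrite /w (hE t).1 (hE t).2.
case: t => [[x y] [x' y']]; rewrite /P /=.
case: (boolP (_ == _)) => [_|ne]; last first.
  rewrite muln0 leqn0 sum_nat_eq0; apply/forallP => m1; apply/implyP => _.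
  rewrite muln_eq0 !eqb0 -negb_and; apply: contra ne => /andP[/eqP e1 /eqP e2].
  apply/eqP; rewrite !natrM.
  transitivity ((y'.+1%:R) ^+ 2 * (x.+1%:R * m) ^+ 2); first by ring.
  rewrite e1; transitivity ((y.+1%:R) ^+ 2 * (y'.+1%:R * m1) ^+ 2); first by ring.
  by rewrite -e2; ring.
rewrite muln1; apply: leq_trans (card_sqr_roots_le2 ((x.+1%:R * m) ^+ 2) (neq0 y)).
rewrite -sum1_card [leqRHS]big_mkcond /=; apply: leq_sum => m1 _.
by rewrite inE [in leqLHS]eq_sym; do 2 case: (_ == _).
Qed.

Lemma cauchy_schwarz (R : realFieldType) (I : Type) (r : seq I) (P : pred I) (a b : I -> R) :
  (\sum_(i <- r | P i) a i * b i) ^+ 2 <=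
  (\sum_(i <- r | P i) a i ^+ 2) * (\sum_(i <- r | P i) b i ^+ 2).
Proof.
have : 0 <= \sum_(i <- r | P i) \sum_(j <- r | P j) (a i * b j - a j * b i) ^+ 2.
  by apply: sumr_ge0 => i _; apply: sumr_ge0 => j _; apply: sqr_ge0.
set A := \sum_(i <- r | P i) a i ^+ 2; set B := \sum_(i <- r | P i) b i ^+ 2.
set c := \sum_(i <- r | P i) a i * b i.
have -> : \sum_(i <- r | P i) \sum_(j <- r | P j) (a i * b j - a j * b i) ^+ 2 =
    2 * (A * B - c ^+ 2).
  under eq_bigr => i _.
    have -> : \sum_(j <- r | P j) (a i * b j - a j * b i) ^+ 2 =
        a i ^+ 2 * B - 2 * (a i * b i) * c + b i ^+ 2 * A.
      rewrite !mulr_sumr -sumrB -big_split /=; apply: eq_bigr => j _; ring.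
    over.
  rewrite big_split /= sumrB -!mulr_suml -mulr_sumr -/A -/B -/c; ring.
by lra.
Qed.

(** After Cauchy-Schwarz over [m1], the range of [m1] is enlarged from [M] to the whole field, so
    that [m1] can be eliminated by [Jcount_product]. *)
Lemma energy_square M S tau : 0 \notin M -> (S < p)%N ->
  (forall u, (0 < u)%N -> (u <= S * S)%N -> (size (divisors u) <= tau)%N) ->
  (energy M S ^ 2 <= #|M| * (2 * (tau * tau * energy M (S * S))))%N.
Proof.
move=> M0 Sp tauP.
have cs : (energy M S ^ 2 <= #|M| * \sum_(m1 in M) (\sum_(m2 in M) Jcount m1 m2 S) ^ 2)%N.
  pose a m1 := (\sum_(m2 in M) Jcount m1 m2 S)%N.
  have e1 : \sum_(m1 in M) 1 * (a m1)%:R = (\sum_(m1 in M) a m1)%N%:R :> rat.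
    by rewrite natr_sum; apply: eq_bigr => m1 _; rewrite mul1r.
  have e2 : \sum_(m1 in M) 1 ^+ 2 = #|M|%:R :> rat.
    by rewrite (eq_bigr (fun=> 1)) ?sumr_const // => m1 _; rewrite expr1n.
  have e3 : \sum_(m1 in M) (a m1)%:R ^+ 2 = (\sum_(m1 in M) a m1 ^ 2)%N%:R :> rat.
    by rewrite natr_sum; apply: eq_bigr => m1 _; rewrite natrX.
  have := cauchy_schwarz (index_enum _) (fun m1 => m1 \in M) (fun=> 1 : rat)
    (fun m1 => (a m1)%:R).
  by rewrite e1 e2 e3 -natrX -natrM ler_nat.
apply: (leq_trans cs); rewrite leq_mul2l; apply/orP; right.
apply: (@leq_trans (\sum_(m1 : 'F_p) \sum_(m in M) \sum_(m' in M)
   Jcount m1 m S * Jcount m1 m' S)).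
  rewrite big_mkcond /=; apply: leq_sum => m1 _; case: ifP => // _.
  by rewrite -mulnn big_distrlr.
rewrite exchange_big /=; under eq_bigr => m _ do rewrite exchange_big /=.
rewrite /energy exchange_big /= mulnA big_distrr /=; apply: leq_sum => m _.
rewrite big_distrr /=; apply: leq_sum => m' _.
by rewrite -mulnA; apply: Jcount_product.
Qed.

Lemma energy_bound (R : realFieldType) M H (tau : nat) (g : R) :
  0 \notin M -> (0 < #|M|)%N -> 0 <= g ->
  (forall u, (0 < u)%N -> (u <= p * p)%N -> (size (divisors u) <= tau)%N) ->
  #|M|%:R ^+ 3 <= p%:R * g ->
  (energy M H)%:R <= 8 * (2 * (16 * tau%:R ^+ 2 * (2 + g)) + 1) *
    (#|M|%:R ^+ 2 + H%:R ^+ 2 * #|M|%:R ^+ 2 / p%:R + H%:R * #|M|%:R) :> R.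
Proof.
move=> M0 Mgt0 g0 tauP Mg.
have p0 : 0 < p%:R :> R by rewrite ltr0n prime_gt0.
have Mp : (#|M| < p)%N.
  by have := max_card (mem (0 |: M)); rewrite cardsU1 M0 card_Fp.
have tau1 : 1 <= tau%:R :> R.
  rewrite -[1]/(1%:R) ler_nat; have := tauP 1%N isT; apply; rewrite muln_gt0.
  by rewrite prime_gt0.
(* [16 = 2 * 8] combines [energy_square] with [energy_doubling]; in [2 + g] the [2] absorbs
   [m ^+ 3 + m ^+ 4] and [g] the term from [m ^+ 3 <= p * g]. *)
set L := 16 * tau%:R ^+ 2 * (2 + g).
have L1 : 1 <= L.
  have : 1 <= tau%:R ^+ 2 :> R by rewrite exprn_ege1.
  by rewrite /L => t2; nra.
set m := #|M|%:R : R; set e := (energy M #|M|)%:R : R.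
have m1 : 1 <= m by rewrite -[1]/(1%:R) ler_nat.
have m0 : 0 < m by apply: lt_le_trans m1.
have e0 : 0 <= e by rewrite /e.
have sq : e ^+ 2 <= m * (2 * (tau%:R * tau%:R * (energy M (#|M| * #|M|))%:R)).
  rewrite /e /m -natrX -!natrM ler_nat; apply: energy_square => // u u0 uM.
  by apply: tauP => //; apply: leq_trans uM _; rewrite leq_mul // ltnW.
have dbl := energy_doubling R (#|M| * #|M|) M0 Mgt0.
rewrite natrM -/m -/e in dbl.
have {}dbl : (energy M (#|M| * #|M|))%:R <= 8 * (m ^+ 2 + m ^+ 3 * g) + 8 * m * (e + m ^+ 2).
  apply: (le_trans dbl); rewrite lerD //; last first.
    by rewrite (_ : m * m / m = m) //; field; rewrite gt_eqF.
  rewrite -mulrA ler_wpM2l // mulrDl mul1r lerD2l.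
  have -> : (m * m) ^+ 2 / p%:R * m ^+ 2 = m ^+ 3 * (m ^+ 3 / p%:R).
    by field; rewrite gt_eqF.
  by rewrite ler_pM2l ?exprn_gt0 // ler_pdivrMr // [g * _]mulrC.
have {}sq : e ^+ 2 <= L * (m ^+ 4 + m ^+ 2 * e).
  apply: (le_trans sq).
  apply: (@le_trans _ _ (m * (2 * (tau%:R * tau%:R *
     (8 * (m ^+ 2 + m ^+ 3 * g) + 8 * m * (e + m ^+ 2)))))).
    by rewrite !ler_wpM2l ?mulr_ge0 // ltW.
  rewrite /L [X in X <= _](_ : _ = 16 * tau%:R ^+ 2 *
     (m ^+ 3 + m ^+ 4 * g + m ^+ 2 * e + m ^+ 4)); last by ring.
  rewrite -[leRHS]mulrA ler_wpM2l ?mulr_ge0 ?exprn_ge0 //.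
  have h1 : m ^+ 3 <= m ^+ 4 by rewrite ler_weXn2l.
  have h2 : 0 <= m ^+ 2 * e by rewrite mulr_ge0 ?exprn_ge0 // ltW.
  have h3 : 0 <= g * (m ^+ 2 * e) by rewrite mulr_ge0.
  by nra.
(* Otherwise both [L * m ^+ 4] and [L * m ^+ 2 * e] would be below half of [e ^+ 2]. *)
have eL : e <= 2 * L * m ^+ 2.
  rewrite leNgt; apply/negP => lt.
  have m2 : 0 < m ^+ 2 by rewrite exprn_gt0.
  have L0 : 0 <= L by apply: le_trans L1.
  have e_gt : 0 < e by apply: le_lt_trans lt; rewrite mulr_ge0 ?(ltW m2) // mulr_ge0.
  have h1 : 2 * L * m ^+ 2 * e < e ^+ 2 by rewrite [e ^+ 2]expr2 ltr_pM2r.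
  have h2 : L * m ^+ 4 <= L * m ^+ 2 * e.
    have -> : L * m ^+ 4 = L * m ^+ 2 * m ^+ 2 by ring.
    rewrite ler_wpM2l ?(mulr_ge0 L0 (ltW m2)) //.
    by apply: ltW; apply: le_lt_trans lt; nra.
  by move: sq; rewrite mulrDr mulrA; lra.
apply: (le_trans (energy_doubling R H M0 Mgt0)); rewrite -/m -/e.
have H0 : 0 <= H%:R :> R by [].
have A0 : 0 <= m ^+ 2 + H%:R ^+ 2 * m ^+ 2 / p%:R.
  by rewrite addr_ge0 ?exprn_ge0 ?divr_ge0 ?mulr_ge0 ?exprn_ge0 // ltW.
apply: (@le_trans _ _ (8 * (m ^+ 2 + H%:R ^+ 2 * m ^+ 2 / p%:R) +
    8 * (2 * L + 1) * (H%:R * m))).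
  have -> : 8 * (1 + H%:R ^+ 2 / p%:R) * m ^+ 2 = 8 * (m ^+ 2 + H%:R ^+ 2 * m ^+ 2 / p%:R).
    by field; rewrite gt_eqF.
  rewrite lerD2l.
  have -> : 8 * (2 * L + 1) * (H%:R * m) = 8 * (H%:R / m) * (2 * L * m ^+ 2 + m ^+ 2).
    by field; rewrite gt_eqF.
  by rewrite ler_wpM2l ?lerD2r // mulr_ge0 // divr_ge0 // ltW.
by rewrite [leRHS]mulrDr lerD2r ler_wpM2r //; lra.
Qed.

End Energy.

(** * Characters extended by zero *)

Section CharExt.
Variables (F : finFieldType) (C : fieldType) (chi : {unit F} -> C).
Hypothesis chi_char : mul_char chi.

Lemma char_ext_val u : char_ext chi (val u) = chi u.
Proof. by rewrite /char_ext valK. Qed.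

Lemma char_ext0 : char_ext chi 0 = 0.
Proof. by rewrite /char_ext insubF // unitr0. Qed.

Lemma neq0_unit_val (x : F) : x != 0 -> exists u : {unit F}, x = val u.
Proof.
move=> x0; have ux : x \is a GRing.unit by rewrite unitfE.
by exists (Sub x ux); rewrite SubK.
Qed.

Lemma char_ext1 : char_ext chi 1 = 1.
Proof.
rewrite -[1]/(val (1%g : {unit F})) char_ext_val.
apply: (mulfI (chi_char.1 1%g)); by rewrite -chi_char.2 mulg1 mulr1.
Qed.

Lemma char_extM x y : char_ext chi (x * y) = char_ext chi x * char_ext chi y.
Proof.
have [->|/neq0_unit_val[u ->]] := eqVneq x 0; first by rewrite mul0r char_ext0 mul0r.
have [->|/neq0_unit_val[v ->]] := eqVneq y 0; first by rewrite mulr0 char_ext0 mulr0.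
by rewrite -[_ * _]/(val (u * v)%g) !char_ext_val chi_char.2.
Qed.

Lemma char_ext_nontriv : nonprincipal chi ->
  exists2 x : F, x != 0 & char_ext chi x != 1.
Proof.
move=> [u chiu]; exists (val u); last by rewrite char_ext_val.
by rewrite -unitfE; exact: (valP u).
Qed.

End CharExt.

(** * Hoelder's inequality with integer exponents *)

Section RealInequalities.
Variable R : realType.

Lemma expr_powR (a x : R) (n : nat) : (a `^ x) ^+ n = a `^ (x * n%:R).
Proof. by rewrite -powR_mulrn ?powR_ge0 // -powRrM. Qed.

Lemma exprD_superadd (a b : R) (n : nat) : (0 < n)%N -> 0 <= a -> 0 <= b ->
  a ^+ n + b ^+ n <= (a + b) ^+ n.
Proof.
case: n => // n _ a0 b0; elim: n => [|n IH]; first by rewrite !expr1.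
rewrite [(a + b) ^+ _]exprS mulrDl ![_ ^+ n.+2]exprS lerD //; rewrite ler_wpM2l //.
  by rewrite lerXn2r ?nnegrE ?addr_ge0 // lerDl.
by rewrite lerXn2r ?nnegrE ?addr_ge0 // lerDr.
Qed.

(** Chebyshev's sum inequality drives the induction: [s] and its powers are ordered alike, so [(s v
    ^+ n.+1 - s w ^+ n.+1) * (s v - s w)] is nonnegative for all [v] and [w]. *)
Lemma power_mean (V : finType) (r s : V -> R) (n : nat) :
  (forall v, 0 <= r v) -> (forall v, 0 <= s v) ->
  (\sum_v r v * s v) ^+ n.+1 <= (\sum_v r v) ^+ n * \sum_v r v * s v ^+ n.+1.
Proof.
move=> r0 s0; elim: n => [|n IH].
  by rewrite expr0 mul1r expr1; apply: ler_sum => v _; rewrite expr1.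
have cheb : (\sum_v r v * s v ^+ n.+1) * (\sum_v r v * s v) <=
    (\sum_v r v) * \sum_v r v * s v ^+ n.+2.
  have : 0 <= \sum_v \sum_w r v * r w * ((s v ^+ n.+1 - s w ^+ n.+1) * (s v - s w)).
    apply: sumr_ge0 => v _; apply: sumr_ge0 => w _.
    apply: mulr_ge0; first by rewrite mulr_ge0.
    have [le|/ltW le] := leP (s v) (s w).
      by rewrite mulr_le0 // subr_le0 // lerXn2r ?nnegrE.
    by rewrite mulr_ge0 // subr_ge0 // lerXn2r ?nnegrE.
  set A := \sum_v r v * s v ^+ n.+1; set B := \sum_v r v * s v.
  set D := \sum_v r v; set E := \sum_v r v * s v ^+ n.+2.
  have -> : \sum_v \sum_w r v * r w * ((s v ^+ n.+1 - s w ^+ n.+1) * (s v - s w)) =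
      2 * (D * E - A * B).
    have inner v : \sum_w r v * r w * ((s v ^+ n.+1 - s w ^+ n.+1) * (s v - s w)) =
        (r v * s v ^+ n.+2) * D - (r v * s v ^+ n.+1) * B - (r v * s v) * A + r v * E.
      rewrite !mulr_sumr -!sumrB -big_split /=; apply: eq_bigr => w _.
      by rewrite ![_ ^+ n.+2]exprS; ring.
    rewrite (eq_bigr _ (fun v _ => inner v)) big_split /= !sumrB -!mulr_suml.
    by rewrite -/A -/B -/D -/E; ring.
  by lra.
have D0 : 0 <= \sum_v r v by apply: sumr_ge0.
have B0 : 0 <= \sum_v r v * s v by apply: sumr_ge0 => v _; rewrite mulr_ge0.
rewrite exprSr; apply: le_trans (ler_wpM2r B0 IH) _.
by rewrite [X in _ <= X * _]exprSr -!mulrA ler_wpM2l ?exprn_ge0.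
Qed.

(** The power mean inequality brings the exponent [l] onto [s], and Cauchy-Schwarz then separates
    [r] from [s ^+ l]. *)
Lemma hoelder_counting (V : finType) (r s : V -> R) (l : nat) : (0 < l)%N ->
  (forall v, 0 <= r v) -> (forall v, 0 <= s v) ->
  (\sum_v r v * s v) ^+ (2 * l) <=
  (\sum_v r v) ^+ (2 * l.-1) * (\sum_v r v ^+ 2) * \sum_v s v ^+ (2 * l).
Proof.
case: l => // l _ r0 s0 /=.
rewrite [(2 * l.+1)%N]mulnC [(2 * l)%N]mulnC !exprM.
have B0 : 0 <= \sum_v r v * s v by apply: sumr_ge0 => v _; rewrite mulr_ge0.
have D0 : 0 <= \sum_v r v by apply: sumr_ge0.
apply: le_trans (_ : ((\sum_v r v) ^+ l * \sum_v r v * s v ^+ l.+1) ^+ 2 <= _).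
  rewrite lerXn2r ?nnegrE ?exprn_ge0 ?mulr_ge0 ?exprn_ge0 ?power_mean //.
  by apply: sumr_ge0 => v _; rewrite mulr_ge0 ?exprn_ge0.
rewrite exprMn -mulrA ler_wpM2l ?exprn_ge0 //.
apply: le_trans (cauchy_schwarz _ _ _ _) _.
by rewrite [X in _ * X <= _](eq_bigr (fun v => s v ^+ (l.+1 * 2))) // => v _; rewrite -exprM.
Qed.

End RealInequalities.

(** * Factors p^o(1) *)

Section Subpower.
Variable R : realType.
Implicit Types f g : nat -> R.

Lemma ln_nat_large (B : R) : exists N : nat, forall n, (N <= n)%N -> B <= ln n%:R.
Proof.
exists (Num.Def.archi_bound (expR B)) => n Nn.
have le : expR B <= n%:R.
  apply: le_trans (ltW (archi_boundP (ltW (expR_gt0 B)))) _.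
  by rewrite ler_nat.
by rewrite -[leLHS]expRK ler_ln ?posrE ?expR_gt0 // (lt_le_trans (expR_gt0 B)).
Qed.

Lemma ln_prime_gt0 p : prime p -> 0 < ln p%:R :> R.
Proof. by move=> /prime_gt1 p1; rewrite ln_gt0 // ltr1n. Qed.

Lemma subpowerP f : subpower f <->
  (forall p, prime p -> 0 < f p) /\
  (forall eps : R, 0 < eps -> exists N : nat, forall p, (N <= p)%N -> prime p ->
     `|ln (f p)| <= eps * ln p%:R).
Proof.
split=> -[f0 h]; split=> //.
  move=> eps eps0; move/cvgrPdist_le: h => /(_ eps eps0).
  rewrite near_withinE => -[N _ hN]; exists N => p Np p_pr.
  have := hN p Np p_pr; rewrite /= sub0r normrN normrM normfV.
  rewrite (gtr0_norm (ln_prime_gt0 p_pr)) ler_pdivrMr //; exact: ln_prime_gt0.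
apply/cvgrPdist_le => eps eps0; rewrite near_withinE.
have [N hN] := h eps eps0; exists N => // p /= Np p_pr.
rewrite sub0r normrN normrM normfV (gtr0_norm (ln_prime_gt0 p_pr)).
by rewrite ler_pdivrMr ?hN //; exact: ln_prime_gt0.
Qed.

Lemma subpower_cst (c : R) : 0 < c -> subpower (fun=> c).
Proof.
move=> c0; apply/subpowerP; split=> // eps eps0.
have [N hN] := ln_nat_large (`|ln c| / eps); exists N => p Np _.
by rewrite -ler_pdivrMl // mulrC hN.
Qed.

Lemma subpowerM f g : subpower f -> subpower g -> subpower (fun p => f p * g p).
Proof.
move=> /subpowerP[f0 hf] /subpowerP[g0 hg]; apply/subpowerP; split.
  by move=> p p_pr; rewrite mulr_gt0 ?f0 ?g0.
move=> eps eps0; have e2 : 0 < eps / 2 by rewrite divr_gt0.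
have [N1 h1] := hf _ e2; have [N2 h2] := hg _ e2.
exists (maxn N1 N2) => p; rewrite geq_max => /andP[p1 p2] p_pr.
rewrite lnM ?posrE ?f0 ?g0 // (le_trans (ler_normD _ _)) //.
by rewrite [eps]splitr mulrDl lerD ?h1 ?h2.
Qed.

Lemma subpower_powR f (a : R) : subpower f -> subpower (fun p => f p `^ a).
Proof.
move=> /subpowerP[f0 hf]; apply/subpowerP; split.
  by move=> p p_pr; rewrite powR_gt0 ?f0.
move=> eps eps0; have a1 : 0 < `|a| + 1 by rewrite ltr_wpDl.
have [N hN] := hf (eps / (`|a| + 1)) (divr_gt0 eps0 a1); exists N => p Np p_pr.
rewrite ln_powR normrM; apply: le_trans (_ : (`|a| + 1) * `|ln (f p)| <= _).
  by rewrite ler_wpM2r // lerDl.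
by rewrite -ler_pdivlMl // mulrA [_^-1 * _]mulrC hN.
Qed.

(** A factor p^o(1) may tend to zero; adding [1] gives one that is at least [1] and can absorb
    constants. *)
Lemma subpower_add1 f : subpower f -> subpower (fun p => 1 + f p).
Proof.
move=> /subpowerP[f0 hf]; apply/subpowerP; split.
  by move=> p p_pr; rewrite addr_gt0 ?f0.
move=> eps eps0; have e2 : 0 < eps / 2 by rewrite divr_gt0.
have /subpowerP[_ h2] := subpower_cst (ltr0n R 2).
have [N1 h1] := hf _ e2; have [N2 {}h2] := h2 _ e2.
exists (maxn N1 N2) => p; rewrite geq_max => /andP[p1 p2] p_pr.
have fp := f0 p p_pr.
have ln0 : 0 <= ln (1 + f p) by rewrite ln_ge0 // lerDl ltW.
rewrite ger0_norm // [eps]splitr mulrDl.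
apply: le_trans (_ : `|ln 2| + `|ln (f p)| <= _); last by rewrite lerD ?h1 ?h2.
have [le1|/ltW le1] := leP (f p) 1.
  apply: le_trans (_ : ln 2 <= _).
    by rewrite ler_ln ?posrE ?addr_gt0 // -[2]/(1 + 1) lerD2l.
  by rewrite (le_trans (ler_norm _)) // lerDl.
apply: le_trans (_ : ln (2 * f p) <= _).
  by rewrite ler_ln ?posrE ?addr_gt0 ?mulr_gt0 // mulr2n mulrDl mul1r lerD2r.
by rewrite lnM ?posrE // lerD ?ler_norm.
Qed.

(** The range up to [p * p] covers the products of two integers below [p] that are factored in the
    energy estimate. *)
Definition max_divisors (p : nat) : nat := \max_(u < (p * p).+1) size (divisors u).

Lemma max_divisorsP p u : (u <= p * p)%N -> (size (divisors u) <= max_divisors p)%N.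
Proof.
move=> up; have lt : (u < (p * p).+1)%N by [].
exact: (leq_bigmax (F := fun u : 'I_(p * p).+1 => size (divisors u)) (Ordinal lt)).
Qed.

Lemma max_divisors_gt0 p : prime p -> (0 < max_divisors p)%N.
Proof.
move=> p_pr; have := max_divisorsP (p := p) (u := 1).
by apply; rewrite muln_gt0 prime_gt0.
Qed.

Lemma subpower_max_divisors : subpower (fun p => (max_divisors p)%:R : R).
Proof.
apply/subpowerP; split=> [p p_pr|eps eps0]; first by rewrite ltr0n max_divisors_gt0.
(* The divisor bound gives [k * ln (max_divisors p) <= ln C + 2 * ln p], eventually at most
   [3 * ln p], and [k * eps >= 4]. *)
pose k := (Num.Def.archi_bound (4 / eps)).+1.
have k0 : 0 < k%:R :> R by rewrite ltr0n.
have keps : 4 / eps <= k%:R :> R.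
  apply: le_trans (ltW (archi_boundP _)) _; first by rewrite divr_ge0 // ltW.
  by rewrite ler_nat leqnSn.
pose C : nat := ((k ^ k) ^ (2 ^ k))%N.
have C0 : (0 < C)%N by rewrite !expn_gt0.
have [N hN] := ln_nat_large (ln C%:R : R); exists N => p Np p_pr.
have p0 : 0 < p%:R :> R by rewrite ltr0n prime_gt0.
have d0 := max_divisors_gt0 p_pr.
rewrite ger0_norm; last by rewrite ln_ge0 // ler1n.
have le : (max_divisors p ^ k <= C * (p * p))%N.
  have [|u uE] := bigop.eq_bigmax (fun u : 'I_(p * p).+1 => size (divisors u)).
    by rewrite card_ord.
  rewrite -/(max_divisors p) in uE.
  have [u0|u0] := posnP u.
    by rewrite uE u0 exp1n !muln_gt0 C0 prime_gt0.
  rewrite uE (leq_trans (size_divisors_bound _ u0)) // leq_mul2l.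
  by apply/orP; right; rewrite -ltnS.
have lnle : k%:R * ln (max_divisors p)%:R <= ln C%:R + 2 * ln p%:R :> R.
  have -> : k%:R * ln (max_divisors p)%:R = ln ((max_divisors p ^ k)%N%:R) :> R.
    by rewrite natrX lnXn ?ltr0n // mulr_natl.
  have -> : ln C%:R + 2 * ln p%:R = ln ((C * (p * p))%N%:R) :> R.
    rewrite natrM lnM ?posrE ?ltr0n // ?muln_gt0 ?prime_gt0 //.
    by rewrite natrM lnM ?posrE //; ring.
  by rewrite ler_ln ?posrE ?ltr0n ?expn_gt0 ?d0 ?muln_gt0 ?C0 ?prime_gt0 // ler_nat.
have lnp := ln_prime_gt0 p_pr.
have l3 : k%:R * ln (max_divisors p)%:R <= 3 * ln p%:R :> R.
  by apply: le_trans lnle _; have := hN p Np; lra.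
rewrite -(ler_pM2l k0); apply: (le_trans l3).
rewrite mulrA ler_wpM2r ?(ltW lnp) //.
by move: keps; rewrite ler_pdivrMr // => keps; apply: le_trans keps; lra.
Qed.

End Subpower.

(** * The complex norm as a real number *)

Section ComplexNorm.
Variable R : realType.
Local Open Scope complex_scope.

Definition cnorm (z : R[i]) : R := complex.Re `|z|.

Lemma cnormE z : `|z| = (cnorm z)%:C.
Proof. by rewrite /cnorm normc_def. Qed.

Lemma cnorm_ge0 z : 0 <= cnorm z.
Proof. rewrite -lecR -cnormE; exact: normr_ge0. Qed.

Lemma complex_archi (x : R[i]) : 0 <= x -> exists n : nat, x < n%:R.
Proof.
move=> x0; exists (Num.Def.archi_bound (cnorm x)).
rewrite -{1}[x]ger0_norm // cnormE -(rmorph_nat (real_complex R)) ltcR.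
exact: archi_boundP (cnorm_ge0 x).
Qed.

Lemma sqrtC_nat n : sqrtC n%:R = (Num.sqrt n%:R)%:C :> R[i].
Proof.
rewrite -[n%:R](_ : (Num.sqrt n%:R)%:C ^+ 2 = _); last first.
  by rewrite -rmorphXn /= sqr_sqrtr // rmorph_nat.
by rewrite sqrCK // lecR sqrtr_ge0.
Qed.

End ComplexNorm.

(** * Fibers and the energy *)

Section Fibers.
Variables (T V : finType) (P : pred T) (g : T -> V).

Definition fiber v : nat := \sum_(t | P t) (g t == v).

Lemma sum_fiber (R : pzSemiRingType) (s : V -> R) :
  \sum_v (fiber v)%:R * s v = \sum_(t | P t) s (g t).
Proof.
rewrite (eq_bigr (fun v => \sum_(t | P t) (g t == v)%:R * s v)) => [|v _]; last first.
  by rewrite natr_sum mulr_suml.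
rewrite exchange_big /=; apply: eq_bigr => t _.
rewrite (bigD1 (g t)) //= eqxx mul1r big1 ?addr0 // => v /negbTE.
by rewrite eq_sym => ->; rewrite mul0r.
Qed.

Lemma sum_fiber_sqr :
  (\sum_v fiber v ^ 2 = \sum_(t | P t) \sum_(t' | P t') (g t == g t'))%N.
Proof.
rewrite (eq_bigr (fun v => \sum_(t | P t) \sum_(t' | P t') (g t == v) * (g t' == v))%N).
  rewrite exchange_big /=; apply: eq_bigr => t _.
  rewrite exchange_big /=; apply: eq_bigr => t' _.
  rewrite (bigD1 (g t)) //= eqxx mul1n big1 ?addn0 // => [|v /negbTE]; first by rewrite eq_sym.
  by rewrite eq_sym => ->.
by move=> v _; rewrite -mulnn big_distrlr.
Qed.

End Fibers.

(** An equality [x / m = y / m'] gives [x m' = y m]; [Jcount] also admits the opposite sign, so only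
    an inequality results. *)
Lemma fiber_energy p (p_pr : prime p) (M : {set 'F_p}) H : 0 \notin M ->
  (\sum_v fiber (fun t : 'I_H * 'F_p => t.2 \in M) (fun t => t.1.+1%:R / t.2) v ^ 2
   <= energy M H)%N.
Proof.
move=> M0; rewrite sum_fiber_sqr.
have nz m : m \in M -> m != 0 by move=> mM; apply: contraNneq M0 => <-.
pose B (x y : 'I_H) (m m' : 'F_p) : nat := (x.+1%:R / m == y.+1%:R / m').
rewrite -(pair_big_dep xpredT (fun _ m => m \in M)
  (fun (x : 'I_H) m => \sum_(t' : 'I_H * 'F_p | t'.2 \in M)
    (x.+1%:R / m == t'.1.+1%:R / t'.2)%R)%N) /=.
rewrite [leqLHS]exchange_big /= /energy; apply: leq_sum => m mM.
rewrite (eq_bigr (fun x => \sum_(m' in M) \sum_y B x y m m')%N) => [|x _]; last first.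
  rewrite exchange_big /= (pair_big_dep xpredT (fun _ m => m \in M)
    (fun y m' => B x y m m')) /=.
  by apply: eq_bigr.
rewrite exchange_big /=; apply: leq_sum => m' m'M.
rewrite pair_big /= /Jcount -sum1_card [leqRHS]big_mkcond /=; apply: leq_sum => -[x y] _.
rewrite /B inE /=; case: eqP => //= E; rewrite ifT //.
have -> : x.+1%:R = y.+1%:R / m' * m by rewrite -E divfK ?nz.
by rewrite mulrAC divfK ?nz.
Qed.

(** * Assembling the bound *)

Section MainBound.
Variables (R : realType) (l : nat).
Hypothesis l_gt0 : (0 < l)%N.
Local Open Scope complex_scope.

Definition moment_const : R := (l ^ (2 * l) + 2 * l + 1)%:R.

Lemma real_moment_bound (F : finFieldType) (chi : {unit F} -> R[i]) (A : {set F})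
    (zeta : F -> R[i]) :
  mul_char chi -> nonprincipal chi -> (forall k, k \in A -> `|zeta k| <= 1) ->
  \sum_v cnorm (\sum_(k in A) zeta k * char_ext chi (v + k)) ^+ (2 * l) <=
  moment_const * (#|A|%:R ^+ l * #|F|%:R + #|A|%:R ^+ (2 * l) * Num.sqrt #|F|%:R) :> R.
Proof.
move=> chi_char chi_np zeta1.
have := moment_bound (@complex_archi R) (char_ext0 chi) (char_ext1 chi_char)
  (char_extM chi_char) (char_ext_nontriv chi_np) l_gt0 zeta1.
under eq_bigr => v _ do rewrite cnormE -rmorphXn /=.
rewrite -rmorph_sum /= sqrtC_nat.
have -> : (l ^ (2 * l))%:R * #|A|%:R ^+ l * #|F|%:R + #|A|%:R ^+ (2 * l) *
    ((2 * l)%:R * (Num.sqrt #|F|%:R)%:C + 1) =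
  ((l ^ (2 * l))%:R * #|A|%:R ^+ l * #|F|%:R + #|A|%:R ^+ (2 * l) *
    ((2 * l)%:R * Num.sqrt #|F|%:R + 1))%:C :> R[i].
  by rewrite !(rmorphD, rmorphM, rmorphXn, rmorph_nat, rmorph1).
rewrite lecR => le; apply: (le_trans le).
have s1 : 1 <= Num.sqrt #|F|%:R :> R.
  rewrite -[leLHS]sqrtr1 ler_sqrt ?ltr01 // -[1]/(1%:R) ler_nat.
  exact: ltnW (finRing_gt1 F).
have a0 : 0 <= #|A|%:R ^+ (2 * l) :> R by rewrite exprn_ge0.
have b0 : 0 <= #|A|%:R ^+ l * #|F|%:R :> R by rewrite mulr_ge0 ?exprn_ge0.
rewrite /moment_const (natrD _ (_ + _)) natrD -mulrA.
set x := _ * #|F|%:R in b0 *; set y := _ ^+ (2 * l) in a0 *.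
have c0 : 0 <= (l ^ (2 * l))%:R :> R by [].
have d0 : 0 <= (2 * l)%:R :> R by [].
set d := (2 * l)%:R in d0 *; set c := (l ^ (2 * l))%:R in c0 *.
have e1 : 0 <= y * Num.sqrt #|F|%:R by rewrite mulr_ge0 ?sqrtr_ge0.
have e2 : y <= y * Num.sqrt #|F|%:R by rewrite ler_peMr.
have e3 : 0 <= d * x by rewrite mulr_ge0.
have e4 : 0 <= c * (y * Num.sqrt #|F|%:R) by rewrite mulr_ge0.
by clear le; lra.
Qed.

Lemma Wsum_fiber_bound p H (K M : {set 'F_p}) (chi : {unit 'F_p} -> R[i])
    (alpha : nat -> R[i]) (zeta eta : 'F_p -> R[i]) :
  0 \notin M -> mul_char chi -> nonprincipal chi ->
  (forall h : nat, (1 <= h <= H)%N -> `|alpha h| <= 1) ->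
  (forall m, m \in M -> `|eta m| <= 1) ->
  cnorm (Wsum H K M chi alpha zeta eta) <=
  \sum_v (fiber (fun t : 'I_H * 'F_p => t.2 \in M) (fun t => t.1.+1%:R / t.2) v)%:R *
     cnorm (\sum_(k in K) zeta k * char_ext chi (v + k)).
Proof.
move=> M0 chi_char chi_np alpha1 eta1.
rewrite sum_fiber -lecR -cnormE rmorph_sum /=.
have -> : Wsum H K M chi alpha zeta eta =
   \sum_(t : 'I_H * 'F_p | t.2 \in M) alpha t.1.+1 * eta t.2 *
     char_ext chi t.2 * (\sum_(k in K) zeta k * char_ext chi (t.1.+1%:R / t.2 + k)).
  rewrite /Wsum big_add1 big_mkord /=.
  rewrite -(pair_big_dep xpredT (fun _ m => m \in M) (fun (x : 'I_H) m =>
    alpha x.+1 * eta m * char_ext chi m *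
     (\sum_(k in K) zeta k * char_ext chi (x.+1%:R / m + k)))) /=.
  apply: eq_bigr => x _; rewrite exchange_big /=; apply: eq_bigr => m mM.
  rewrite mulr_sumr; apply: eq_bigr => k _.
  have m0 : m != 0 by apply: contraNneq M0 => <-.
  have -> : x.+1%:R + k * m = m * (x.+1%:R / m + k).
    by rewrite mulrDr mulrCA divff // mulr1 [m * k]mulrC.
  by rewrite (char_extM chi_char); ring.
apply: (le_trans (ler_norm_sum _ _ _)); apply: ler_sum => -[x m] /= mM.
have m0 : m != 0 by apply: contraNneq M0 => <-.
rewrite -cnormE !normrM -[leRHS]mul1r ler_wpM2r //.
rewrite (norm_chi (char_ext1 chi_char) (char_extM chi_char) (char_ext_nontriv chi_np) m0) mulr1.
by rewrite mulr_ile1 ?alpha1 ?eta1 ?ltn_ord.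
Qed.

End MainBound.

(** Taking out [(H * M) ^ (2 l)] turns the energy factor into [1 / p + 1 / (H M) + 1 / H ^ 2], and
    taking out [K ^ (2 l)] turns the moment into [sqrt p + p / K ^ l]. The summands are the [2 l]-th
    powers of those in the final bound, and superadditivity of powers allows the root to be taken
    termwise. *)
Lemma weighted_powers (R : realType) (l : nat) (p H K M T C : R) :
  (0 < l)%N -> 0 < p -> 0 < H -> 0 < K -> 0 < M -> 0 <= T -> 0 <= C ->
  (H * M) ^+ (2 * l.-1) * (T * (M ^+ 2 + H ^+ 2 * M ^+ 2 / p + H * M)) *
    (C * (K ^+ l * p + K ^+ (2 * l) * Num.sqrt p)) <=
  (H * K * M
   * (p `^ (- (1 / (2 * l%:R)))
      + H `^ (- (1 / (2 * l%:R))) * M `^ (- (1 / (2 * l%:R)))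
      + H `^ (- (1 / l%:R)))
   * (p `^ (1 / (4 * l%:R)) + K `^ (- (1 / 2)) * p `^ (1 / (2 * l%:R)))
   * (T * C) `^ (1 / (2 * l%:R))) ^+ (2 * l).
Proof.
move=> l_gt0 p0 H0 K0 M0 T0 C0.
have l0 : l%:R != 0 :> R by rewrite pnatr_eq0 -lt0n.
have l2 : (0 < 2 * l)%N by rewrite muln_gt0.
have lE : (2 * l = 2 * l.-1 + 2)%N by rewrite addnC -mulnS prednK.
have TC0 : 0 <= T * C by rewrite mulr_ge0.
set x := p `^ _; set y := H `^ _ * _; set z := H `^ _.
set w := p `^ _; set t := K `^ _ * _; set f := (T * C) `^ _.
have inv2l (a : R) : 0 < a -> (a `^ (- (1 / (2 * l%:R)))) ^+ (2 * l) = a^-1.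
  move=> a0; rewrite expr_powR natrM (_ : _ * _ = -1); last by field.
  by rewrite powR_inv1 // ltW.
have xE : x ^+ (2 * l) = p^-1 by apply: inv2l.
have yE : y ^+ (2 * l) = H^-1 * M^-1 by rewrite exprMn !inv2l.
have zE : z ^+ (2 * l) = (H ^+ 2)^-1.
  rewrite expr_powR natrM (_ : _ * _ = - 2); last by field.
  by rewrite powRN powR_mulrn // ltW.
have wE : w ^+ (2 * l) = Num.sqrt p.
  rewrite expr_powR natrM (_ : 1 / (4 * l%:R) * (2 * l%:R) = 2^-1); last by field.
  by rewrite powR12_sqrt // ltW.
have tE : t ^+ (2 * l) = (K ^+ l)^-1 * p.
  rewrite exprMn !expr_powR natrM (_ : - (1 / 2) * _ = - l%:R); last by field.
  rewrite (_ : 1 / _ * _ = 1); last by field.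
  by rewrite powRN powR_mulrn ?powRr1 // ltW.
have fE : f ^+ (2 * l) = T * C.
  rewrite expr_powR natrM (_ : 1 / (2 * l%:R) * (2 * l%:R) = 1); last by field.
  by rewrite powRr1.
have x0 : 0 <= x by apply: powR_ge0.
have y0 : 0 <= y by rewrite mulr_ge0 ?powR_ge0.
have z0 : 0 <= z by apply: powR_ge0.
have w0 : 0 <= w by apply: powR_ge0.
have t0 : 0 <= t by rewrite mulr_ge0 ?powR_ge0.
rewrite !exprMn fE.
have h1 : p^-1 + H^-1 * M^-1 + (H ^+ 2)^-1 <= (x + y + z) ^+ (2 * l).
  rewrite -xE -yE -zE; apply: le_trans (exprD_superadd l2 (addr_ge0 x0 y0) z0).
  by rewrite lerD2r exprD_superadd.
have h2 : Num.sqrt p + (K ^+ l)^-1 * p <= (w + t) ^+ (2 * l).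
  by rewrite -wE -tE exprD_superadd.
apply: le_trans (_ : H ^+ (2 * l) * K ^+ (2 * l) * M ^+ (2 * l) *
   (p^-1 + H^-1 * M^-1 + (H ^+ 2)^-1) * (Num.sqrt p + (K ^+ l)^-1 * p) * (T * C) <= _).
  rewrite le_eqVlt; apply/orP; left; apply/eqP.
  have kn : K ^+ l != 0 by rewrite expf_neq0 // gt_eqF.
  have hE : H ^+ (2 * l) = H ^+ (2 * l.-1) * H ^+ 2.
    by rewrite [in LHS]lE exprD.
  have mE : M ^+ (2 * l) = M ^+ (2 * l.-1) * M ^+ 2.
    by rewrite [in LHS]lE exprD.
  have kE : K ^+ (2 * l) = (K ^+ l) ^+ 2 by rewrite mulnC exprM.
  rewrite hE mE kE; set k := K ^+ l in kn *.
  set hh := H ^+ (2 * l.-1); set mm := M ^+ (2 * l.-1).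
  by field; rewrite kn !gt_eqF.
rewrite ler_wpM2r // -!mulrA !ler_wpM2l ?exprn_ge0 ?(ltW H0) ?(ltW K0) ?(ltW M0) //.
by rewrite ler_pM // ?addr_ge0 ?mulr_ge0 ?invr_ge0 ?exprn_ge0 ?sqrtr_ge0
  ?(ltW H0) ?(ltW K0) ?(ltW M0) ?(ltW p0).
Qed.

Local Open Scope complex_scope.

Theorem theorem2p2 (R : realType) (l : nat) (hl : (1 <= l)%N)
    (g : nat -> R) (hg : subpower g) :
  exists f : nat -> R, subpower f /\
    forall (p H : nat) (K M : {set 'F_p}) (chi : {unit 'F_p} -> R[i])
           (alpha : nat -> R[i]) (zeta eta : 'F_p -> R[i]),
      prime p ->
      (1 <= H < p)%N ->
      0 \notin K -> 0 \notin M ->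
      mul_char chi -> nonprincipal chi ->
      (forall h : nat, (1 <= h <= H)%N -> `|alpha h| <= 1) ->
      (forall k, k \in K -> `|zeta k| <= 1) ->
      (forall m, m \in M -> `|eta m| <= 1) ->
      #|M|%:R <= p%:R `^ (1 / 3) * g p ->
      `|Wsum H K M chi alpha zeta eta| <=
        (H%:R * #|K|%:R * #|M|%:R
         * (p%:R `^ (- (1 / (2 * l%:R)))
            + H%:R `^ (- (1 / (2 * l%:R))) * #|M|%:R `^ (- (1 / (2 * l%:R)))
            + H%:R `^ (- (1 / l%:R)))
         * (p%:R `^ (1 / (4 * l%:R))
            + #|K|%:R `^ (- (1 / 2)) * p%:R `^ (1 / (2 * l%:R)))
         * f p)%:C.
Proof.
(* Cubing the hypothesis on [#|M|] gives [#|M| ^ 3 <= p * G p]; the [1] ensures [G p >= 1]. *)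
pose G p := (1 + g p) `^ 3%:R.
(* [97 = 3 * 32 + 1]: as [tau] and [G] are at least [1], the constant
   [2 * (16 * tau ^ 2 * (2 + G)) + 1] of [energy_bound] is at most [97 * tau ^ 2 * G]. *)
pose Theta p := (8 * 97 * moment_const R l) * ((max_divisors p)%:R `^ 2%:R * G p).
have C0 : 0 < 8 * 97 * moment_const R l by rewrite !mulr_gt0 // ltr0n addn1.
exists (fun p => Theta p `^ (1 / (2 * l%:R))); split.
  apply: subpower_powR; apply: subpowerM; first exact: subpower_cst.
  apply: subpowerM; apply: subpower_powR; first exact: subpower_max_divisors.
  exact: subpower_add1.
move=> p H K M chi alpha zeta eta p_pr /andP[H1 Hp] K0 M0 chi_char chi_np.
move=> alpha1 zeta1 eta1 Mg.
have l0 : 0 < l%:R :> R by rewrite ltr0n.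
rewrite cnormE lecR.
set W := Wsum _ _ _ _ _ _ _.
set RHS := (X in _ <= X).
have p0 : 0 < p%:R :> R by rewrite ltr0n prime_gt0.
have H0 : 0 < H%:R :> R by rewrite ltr0n.
have RHS0 : 0 <= RHS.
  by rewrite /RHS !mulr_ge0 ?addr_ge0 ?mulr_ge0 ?powR_ge0.
(* Empty [K] or [M] is set apart because the computation with negative powers needs positive
   cardinalities; [W] then vanishes. *)
have [K_eq0|K_gt0] := posnP #|K|.
  have -> : W = 0.
    rewrite /W /Wsum big1 // => h _; rewrite big1 // => k.
    by rewrite (cards0_eq K_eq0) inE.
  by rewrite /cnorm normr0.
have [M_eq0|M_gt0] := posnP #|M|.
  have -> : W = 0.
    rewrite /W /Wsum big1 // => h _; rewrite big1 // => k _; rewrite big1 // => m.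
    by rewrite (cards0_eq M_eq0) inE.
  by rewrite /cnorm normr0.
have K0' : 0 < #|K|%:R :> R by rewrite ltr0n.
have M0' : 0 < #|M|%:R :> R by rewrite ltr0n.
have g0 : 0 < g p by have [gp _] := hg; apply: gp.
have G1 : 1 <= G p by rewrite /G powR_mulrn ?exprn_ege1 ?addr_ge0 ?lerDl ?ltW.
have MG : #|M|%:R ^+ 3 <= p%:R * G p.
  apply: le_trans (_ : (p%:R `^ (1 / 3) * g p) ^+ 3 <= _).
    by rewrite lerXn2r ?nnegrE ?mulr_ge0 ?powR_ge0 // ltW.
  rewrite exprMn expr_powR (_ : 1 / 3 * 3%:R = 1); last by field.
  rewrite powRr1 ?(ltW p0) // ler_pM2l // /G powR_mulrn ?addr_ge0 ?(ltW g0) //.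
  by rewrite lerXn2r ?nnegrE ?addr_ge0 ?lerDr // (ltW g0).
set tau := max_divisors p.
have tau1 : 1 <= tau%:R :> R by rewrite -[1]/(1%:R) ler_nat max_divisors_gt0.
have tauP u : (0 < u)%N -> (u <= p * p)%N -> (size (divisors u) <= tau)%N.
  by move=> _; exact: max_divisorsP.
pose T := tau%:R ^+ 2 * G p.
have T1 : 1 <= T by rewrite mulr_ege1 // exprn_ege1.
pose r v : R := (fiber (fun t : 'I_H * 'F_p => t.2 \in M) (fun t => t.1.+1%:R / t.2) v)%:R.
pose s v : R := cnorm (\sum_(k in K) zeta k * char_ext chi (v + k)).
have Wle : cnorm W <= \sum_v r v * s v by apply: Wsum_fiber_bound.
have sum_r : \sum_v r v = H%:R * #|M|%:R.
  have := sum_fiber (fun t : 'I_H * 'F_p => t.2 \in M) (fun t => t.1.+1%:R / t.2)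
    (fun=> 1 : R).
  rewrite (eq_bigr r) => [->|v _]; last by rewrite mulr1.
  rewrite -(pair_big_dep xpredT (fun _ m => m \in M) (fun (_ : 'I_H) _ => 1)) /=.
  by rewrite !sumr_const card_ord -[LHS]mulr_natl.
have sum_r2 : \sum_v r v ^+ 2 <= 8 * 97 * T *
    (#|M|%:R ^+ 2 + H%:R ^+ 2 * #|M|%:R ^+ 2 / p%:R + H%:R * #|M|%:R).
  apply: le_trans (_ : (energy M H)%:R <= _).
    rewrite (eq_bigr (fun v => (fiber (fun t : 'I_H * 'F_p => t.2 \in M)
      (fun t => t.1.+1%:R / t.2) v ^ 2)%N%:R)) => [|v _]; last by rewrite natrX.
    by rewrite -natr_sum ler_nat fiber_energy.
  apply: le_trans (energy_bound p_pr H M0 M_gt0 (le_trans ler01 G1) tauP MG) _.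
  rewrite ler_wpM2r ?addr_ge0 ?mulr_ge0 ?exprn_ge0 ?invr_ge0 ?(ltW p0) //.
  have : tau%:R ^+ 2 <= T by rewrite ler_peMr ?exprn_ge0.
  by move: T1; rewrite /T => T1 le; lra.
have sum_s := real_moment_bound hl chi_char chi_np zeta1.
rewrite card_Fp // -/s in sum_s.
have l2 : (0 < 2 * l)%N by rewrite muln_gt0.
rewrite -(ler_pXn2r l2) ?nnegrE ?cnorm_ge0 //.
apply: le_trans (_ : (\sum_v r v * s v) ^+ (2 * l) <= _).
  by rewrite lerXn2r ?nnegrE ?cnorm_ge0 // (le_trans (cnorm_ge0 _) Wle).
have r0 v : 0 <= r v by [].
have s0 v : 0 <= s v by apply: cnorm_ge0.
apply: le_trans (hoelder_counting hl r0 s0) _.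
rewrite sum_r.
apply: le_trans (_ : (H%:R * #|M|%:R) ^+ (2 * l.-1) * (8 * 97 * T *
    (#|M|%:R ^+ 2 + H%:R ^+ 2 * #|M|%:R ^+ 2 / p%:R + H%:R * #|M|%:R)) *
    (moment_const R l * (#|K|%:R ^+ l * p%:R + #|K|%:R ^+ (2 * l) * Num.sqrt p%:R)) <= _).
  rewrite ler_pM ?ler_wpM2l ?mulr_ge0 ?exprn_ge0 ?(ltW H0) ?(ltW M0') //.
  - by apply: sumr_ge0 => v _; rewrite exprn_ge0.
  - by apply: sumr_ge0 => v _; rewrite exprn_ge0.
have ThetaE : Theta p = 8 * 97 * T * moment_const R l.
  by rewrite /Theta /T powR_mulrn //; ring.
rewrite /RHS ThetaE; apply: weighted_powers => //.
by rewrite !mulr_ge0 // (le_trans ler01).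
Qed.
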